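(* Let $J$ be Dunwoody's inaccessible group (constructed explicitly in the context). Then $J$ does not admit a universal acylindrical action; that is, there is no acylindrical action of $J$ on a hyperbolic space for which every generalized loxodromic element of $J$ is loxodromic.
   Context: **Acylindrical actions.** All group actions on metric spaces are by isometries, and a hyperbolic space is a geodesic metric space that is hyperbolic in the sense of Gromov. An action of a group $G$ on a metric space $(X,d)$ is *acylindrical* if for all $\epsilon>0$ there exist constants $M,N\ge 0$ such that for all $x,y\in X$ with $d(x,y)\ge M$, the number of elements $g\in G$ satisfying $d(x,gx)\le\epsilon$ and $d(y,gy)\le\epsilon$ is at most $N$. Given a group $G$ acting on a hyperbolic space $X$, an element $g\in G$ is *loxodromic* (for this action) if the map $\mathbb{Z}\to X$, $n\mapsto g^n s$, is a quasi-isometric embedding for some (equivalently, any) $s\in X$. An element $g\in G$ is *generalized loxodromic* if there is some acylindrical action of $G$ on some hyperbolic space for which $g$ is loxodromic. A group $G$ *has (admits) a universal acylindrical action* if there is an acylindrical action of $G$ on a hyperbolic space for which all generalized loxodromic elements of $G$ are loxodromic. **Dunwoody's inaccessible group $J$.** Let $H$ be the group of permutations of $\mathbb{Z}$ generated by the transposition $(0\,1)$ and the shift $s(i)=i+1$. For $i\ge 1$ let $[-i,i]$ denote the set of integers from $-i$ to $i$, and let $H_i\subset H$ be the subgroup of permutations supported on $[-i,i]$ (so $H_i$ is the group of all permutations of $[-i,i]$, extended by the identity). Let $H_\omega=\bigcup_i H_i\subset H$ be the group of finitely supported permutations of $\mathbb{Z}$. Let $V$ be the group of all maps $\mathbb{Z}\to\mathbb{Z}/2\mathbb{Z}$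 under the pointwise operation, where $\mathbb{Z}/2\mathbb{Z}$ is written multiplicatively as $\{1,-1\}$, and let $V_i\subset V$ be the subgroup of maps supported on $[-i,i]$ (i.e. equal to $1$ outside $[-i,i]$). The group $H_i$ acts on $V_i$ by ${}^{h}v(j)=v(h^{-1}(j))$. Let $G_i'=V_i\rtimes H_i$, with operation $(v_0h_0)(v_1h_1)=(v_0\,{}^{h_0}v_1)(h_0h_1)$. Let $z_i\in V_i$ be the map sending every element of $[-i,i]$ to $-1$ and all other integers to $1$. Then $z_i$ is central in $G_i'$, and one sets $K_i=\langle z_i\rangle\times H_i\subset G_i'$. Since $V_i\subset V_{i+1}$ and $H_i\subset H_{i+1}$, the group $K_i$ is also a subgroup of $G_{i+1}'$. Let $G_i$ ($i\ge1$) be pairwise disjoint isomorphic copies of the $G_i'$, and identify $K_i$ with its image in $G_i$ and with its image in $G_{i+1}$. Form the infinite iterated amalgamated product $$G_1*_{K_1}G_2*_{K_2}\cdots*_{K_n}G_{n+1}*_{K_{n+1}}\cdots$$ (the direct limit of the finite iterated amalgamated products). For $n\ge1$ let $Q_n=G_{n+1}*_{K_{n+1}}G_{n+2}*_{K_{n+2}}\cdots$ be the part to the right of $K_n$, so that the whole product is $G_1*_{K_1}G_2*_{K_2}\cdots*_{K_n}Q_n$, with $K_n\subset G_{n+1}\subset Q_n$. In $G_{i+1}$ one has $K_i\cap K_{i+1}=H_i$, and the copies of the $H_i$ are nested in $Q_n$, so $H_\omega\subset Q_n$. Put $J_n=Q_n*_{H_\omega}H$ (amalgamation along $H_\omega\subset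 Q_n$ and $H_\omega\subset H$). Dunwoody's inaccessible group is $$J=G_1*_{K_1}G_2*_{K_2}\cdots*_{K_n}J_n,$$ which does not depend on the choice of $n$. *)

(* Defs.v *)
From HB Require Import structures.
From mathcomp Require Import all_boot all_order all_algebra.
From mathcomp Require Import all_classical all_reals all_analysis.
From mathcomp Require Import zify.

Set Implicit Arguments.
Unset Strict Implicit.
Unset Printing Implicit Defensive.

Import Order.TTheory GRing.Theory Num.Theory.
Local Open Scope classical_set_scope.
Local Open Scope ring_scope.

Definition geodesic (R : realType) (X : metricType R) : Prop :=
  forall x y : X, exists c : R -> X,
    [/\ c 0 = x, c (mdist x y) = y &
        {in `[0, mdist x y] &, forall s t, mdist (c s) (c t) = `|s - t|}].

Definition gromov_product (R : realType) (X : metricType R) (w x y : X) : R :=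
  (mdist x w + mdist y w - mdist x y) / 2.

(* Gromov's four-point condition, on a geodesic space. *)
Definition hyperbolic (R : realType) (X : metricType R) : Prop :=
  geodesic X /\
  exists delta : R, forall w x y z : X,
    Num.min (gromov_product w x y) (gromov_product w y z) - delta
      <= gromov_product w x z.

Record isom_action (R : realType) (G : groupType) (X : metricType R) :=
  IsomAction {
    act :> G -> X -> X;
    act1 : forall x, act 1%g x = x;
    actM : forall g h x, act (g * h)%g x = act g (act h x);
    act_isom : forall g x y, mdist (act g x) (act g y) = mdist x y }.

Definition acylindrical (R : realType) (G : groupType) (X : metricType R)
    (a : isom_action G X) : Prop :=
  forall eps : R, 0 < eps ->
    exists (M : R) (N : nat), 0 <= M /\
      forall x y : X, M <= mdist x y ->
        ([set g : G | mdist x (a g x) <= eps /\ mdist y (a g y) <= eps]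
           #<= `I_N)%card.

Definition quasi_isometric_embedding (R : realType) (X : metricType R)
    (f : int -> X) : Prop :=
  exists lambda c : R, [/\ 1 <= lambda, 0 <= c & forall m n : int,
    lambda^-1 * `|m - n|%:~R - c <= mdist (f m) (f n)
      <= lambda * `|m - n|%:~R + c].

Definition zpow (G : groupType) (g : G) (n : int) : G :=
  match n with Posz k => (g ^+ k)%g | Negz k => (g ^- k.+1)%g end.

Definition loxodromic (R : realType) (G : groupType) (X : metricType R)
    (a : isom_action G X) (g : G) : Prop :=
  exists s : X, quasi_isometric_embedding (fun n : int => a (zpow g n) s).

Definition generalized_loxodromic (R : realType) (G : groupType) (g : G) : Prop :=
  exists (X : metricType R) (a : isom_action G X),
    [/\ hyperbolic X, acylindrical a & loxodromic a g].

Definition has_universal_acylindrical_action (R : realType) (G : groupType) : Prop :=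
  exists (X : metricType R) (a : isom_action G X),
    [/\ hyperbolic X, acylindrical a &
        forall g : G, generalized_loxodromic R g -> loxodromic a g].

Local Open Scope group_scope.

Definition subgrp (G : groupType) (S : groupClosed G) := {x : G | x \in S}.

Section Subgrp.
Variables (G : groupType) (S : groupClosed G).

Lemma subgrp_closed : group_closed (fun x : G => x \in S).
Proof.
by split=> [|x y xS yS]; [exact: (@gpred1 _ S)|exact: (@gpredF _ S x y xS yS)].
Qed.

HB.instance Definition _ := [isSub of subgrp S for @sval _ _].
HB.instance Definition _ := [Choice of subgrp S by <:].
HB.instance Definition _ :=
  SubChoice_isSubGroup.Build G (fun x : G => x \in S) (subgrp S) subgrp_closed.
End Subgrp.

Definition subgrp_incl (G : groupType) (S T : groupClosed G)
    (ST : {subset S <= T}) (x : subgrp S) : subgrp T :=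
  exist _ (sval x) (ST _ (svalP x)).

Lemma subgrp_inclM (G : groupType) (S T : groupClosed G) (ST : {subset S <= T}) :
  {morph subgrp_incl ST : x y / x * y}.
Proof. by move=> x y; apply: val_inj. Qed.

HB.instance Definition _ (G : groupType) (S T : groupClosed G)
    (ST : {subset S <= T}) :=
  isMultiplicative.Build _ _ (subgrp_incl ST) (subgrp_inclM ST).

Definition subgrp_val (G : groupType) (S : groupClosed G) (x : subgrp S) : G :=
  sval x.

Lemma subgrp_valM (G : groupType) (S : groupClosed G) :
  {morph @subgrp_val G S : x y / x * y}.
Proof. by []. Qed.

HB.instance Definition _ (G : groupType) (S : groupClosed G) :=
  isMultiplicative.Build _ _ (@subgrp_val G S) (@subgrp_valM G S).

Definition generated (G : groupType) (A : set G) : {pred G} :=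
  fun x => `[< forall S : groupClosed G, (forall y, A y -> y \in S) -> x \in S >].

Section Generated.
Variables (G : groupType) (A : set G).

Lemma generated_mul : mulg_closed (generated A).
Proof.
move=> x y /asboolP xA /asboolP yA; apply/asboolP => S AS.
by apply: gpredM; [exact: xA|exact: yA].
Qed.
Lemma generated_one : 1 \in generated A.
Proof. by apply/asboolP => S AS; exact: gpred1. Qed.
Lemma generated_inv : invg_closed (generated A).
Proof.
by move=> x /asboolP xA; apply/asboolP => S AS; apply: gpredVr; exact: xA.
Qed.

HB.instance Definition _ := isMulClosed.Build G (generated A) generated_mul.
HB.instance Definition _ := isMul1Closed.Build G (generated A) generated_one.
HB.instance Definition _ := isInvClosed.Build G (generated A) generated_inv.
End Generated.

(* [colim F E] is the free product of the groups [F i] modulo the relations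
   [u = v] for [E u v]: words in the disjoint union of the [F i], modulo the
   monoid congruence generated by the multiplication tables and by [E]. *)
Section Colim.
Variables (I : choiceType) (F : I -> groupType).
Variable E : {i : I & F i} -> {i : I & F i} -> Prop.

Inductive colim_eqv : seq {i : I & F i} -> seq {i : I & F i} -> Prop :=
| ceqv_refl s : colim_eqv s s
| ceqv_sym s t : colim_eqv s t -> colim_eqv t s
| ceqv_trans s t u : colim_eqv s t -> colim_eqv t u -> colim_eqv s u
| ceqv_cat s s' t t' :
    colim_eqv s s' -> colim_eqv t t' -> colim_eqv (s ++ t) (s' ++ t')
| ceqv_one i : colim_eqv [:: Tagged F (1 : F i)] [::]
| ceqv_mul i (x y : F i) :
    colim_eqv [:: Tagged F x; Tagged F y] [:: Tagged F (x * y)]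
| ceqv_rel u v : E u v -> colim_eqv [:: u] [:: v].

Definition colim_rel : rel (seq {i : I & F i}) :=
  fun s t => `[< colim_eqv s t >].

Lemma colim_rel_refl : reflexive colim_rel.
Proof. by move=> s; apply/asboolP; constructor. Qed.
Lemma colim_rel_sym : symmetric colim_rel.
Proof. by move=> s t; apply/asboolP/asboolP; exact: ceqv_sym. Qed.
Lemma colim_rel_trans : transitive colim_rel.
Proof.
move=> t s u /asboolP st /asboolP tu; apply/asboolP; exact: ceqv_trans st tu.
Qed.

Definition colim_equiv :=
  EquivRel colim_rel colim_rel_refl colim_rel_sym colim_rel_trans.

Definition colim := {eq_quot colim_equiv}%qT.

HB.instance Definition _ := Choice.on colim.
HB.instance Definition _ := EqQuotient.on colim.

Definition colim_class (s : seq {i : I & F i}) : colim := (\pi_colim s)%qT.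

Lemma colim_classP s t : colim_class s = colim_class t <-> colim_eqv s t.
Proof.
split=> [/eqmodP/asboolP//|st]; apply/eqmodP; exact/asboolP.
Qed.

Lemma colim_repr s : colim_eqv (repr (colim_class s)) s.
Proof. by apply/colim_classP; rewrite /colim_class reprK. Qed.

Lemma colim_reprK x : colim_class (repr x) = x.
Proof. by rewrite /colim_class reprK. Qed.

Definition word_inv (s : seq {i : I & F i}) : seq {i : I & F i} :=
  rev [seq Tagged F (tagged u : F _)^-1 | u : {i : I & F i} <- s].

Definition colim_one : colim := colim_class [::].
Definition colim_mul (x y : colim) : colim := colim_class (repr x ++ repr y).
Definition colim_inv (x : colim) : colim := colim_class (word_inv (repr x)).

Lemma colim_mulE s t :
  colim_mul (colim_class s) (colim_class t) = colim_class (s ++ t).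
Proof. by apply/colim_classP; apply: ceqv_cat; exact: colim_repr. Qed.

Lemma colim_mulA : associative colim_mul.
Proof.
move=> x y z; rewrite -(colim_reprK x) -(colim_reprK y) -(colim_reprK z).
by rewrite !colim_mulE catA.
Qed.
Lemma colim_mul1 : left_id colim_one colim_mul.
Proof. by move=> x; rewrite -(colim_reprK x) colim_mulE. Qed.
Lemma colim_mulr1 : right_id colim_one colim_mul.
Proof. by move=> x; rewrite -(colim_reprK x) colim_mulE cats0. Qed.

Lemma word_invV s : colim_eqv (word_inv s ++ s) [::].
Proof.
elim: s => [|[i x] s IH]; first exact: ceqv_refl.
rewrite /word_inv /= rev_cons cat_rcons -[_ :: _ :: s]/([:: _; _] ++ s).
apply: ceqv_trans IH; apply: ceqv_cat; first exact: ceqv_refl.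
rewrite -[X in colim_eqv _ X]cat0s; apply: ceqv_cat; last exact: ceqv_refl.
by apply: ceqv_trans (ceqv_mul _ _) _; rewrite mulVg; exact: ceqv_one.
Qed.
Lemma word_invK s : word_inv (word_inv s) = s.
Proof.
rewrite /word_inv map_rev revK -map_comp -[RHS]map_id.
by apply: eq_map => -[i x] /=; rewrite invgK.
Qed.
Lemma colim_mulV : left_inverse colim_one colim_inv colim_mul.
Proof.
move=> x; rewrite -[X in colim_mul _ X]colim_reprK colim_mulE.
by apply/colim_classP; exact: word_invV.
Qed.
Lemma colim_mulrV : right_inverse colim_one colim_inv colim_mul.
Proof.
move=> x; rewrite -[X in colim_mul X _]colim_reprK colim_mulE.
apply/colim_classP; rewrite -[X in X ++ _]word_invK; exact: word_invV.
Qed.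

HB.instance Definition _ := isGroup.Build colim
  colim_mulA colim_mul1 colim_mulr1 colim_mulV colim_mulrV.

Definition colim_in (i : I) (x : F i) : colim := colim_class [:: Tagged F x].

Lemma colim_inM i : {morph @colim_in i : x y / x * y}.
Proof.
by move=> x y; rewrite [RHS]colim_mulE; apply/esym/colim_classP/ceqv_mul.
Qed.

HB.instance Definition _ i :=
  isMultiplicative.Build (F i) colim (@colim_in i) (@colim_inM i).

Lemma colim_in_rel u v : E u v -> colim_in (tagged u) = colim_in (tagged v).
Proof. by case: u v => [i x] [j y] uv; apply/colim_classP/ceqv_rel. Qed.
End Colim.

Section Amalgam.
Variables (A B C : groupType).
Variables (f : {multiplicative C -> A}) (g : {multiplicative C -> B}).

Definition amalgam_factor (b : bool) : groupType := if b then A else B.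

Inductive amalgam_rel :
    {b : bool & amalgam_factor b} -> {b : bool & amalgam_factor b} -> Prop :=
| AmalgamRel c : amalgam_rel (@Tagged _ true amalgam_factor (f c))
                             (@Tagged _ false amalgam_factor (g c)).

Definition amalgam : groupType := colim amalgam_rel.
Definition amalgam_l : {multiplicative A -> amalgam} :=
  (@colim_in _ _ amalgam_rel true
    : {multiplicative amalgam_factor true -> colim amalgam_rel}).
Definition amalgam_r : {multiplicative B -> amalgam} :=
  (@colim_in _ _ amalgam_rel false
    : {multiplicative amalgam_factor false -> colim amalgam_rel}).

Lemma amalgam_glue c : amalgam_l (f c) = amalgam_r (g c).
Proof. exact: colim_in_rel (AmalgamRel c). Qed.
End Amalgam.

Section Dirlim.
Variables (D : nat -> groupType) (s : forall k, {multiplicative D k -> D k.+1}).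

Inductive dirlim_rel : {k : nat & D k} -> {k : nat & D k} -> Prop :=
| DirlimRel k (x : D k) : dirlim_rel (Tagged D x) (Tagged D (s k x)).

Definition dirlim : groupType := colim dirlim_rel.
Definition dirlim_in k : {multiplicative D k -> dirlim} :=
  (@colim_in _ _ dirlim_rel k : {multiplicative D k -> colim dirlim_rel}).

Lemma dirlim_glue k (x : D k) : dirlim_in k x = dirlim_in k.+1 (s k x).
Proof. exact: colim_in_rel (DirlimRel x). Qed.
End Dirlim.

(* A group together with a homomorphism from [G]. *)
Record grp_under (G : groupType) := GrpUnder {
  under_grp :> groupType;
  under_in : {multiplicative G -> under_grp} }.

Section IteratedAmalgam.
Variables G K : nat -> groupType.
Variables (f : forall k, {multiplicative K k -> G k})
          (g : forall k, {multiplicative K k -> G k.+1}).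

(* [iter_amalgam k] is [G 0 *_(K 0) G 1 *_(K 1) ... *_(K k.-1) G k], together
   with the canonical map from its last factor. *)
Fixpoint iter_amalgam (k : nat) : grp_under (G k) :=
  match k with
  | 0%N => @GrpUnder (G 0%N) (G 0%N) idfun
  | j.+1 => GrpUnder (amalgam_r (under_in (iter_amalgam j) \o f j) (g j))
  end.

Definition iter_amalgam_step (k : nat) :
    {multiplicative iter_amalgam k -> iter_amalgam k.+1} :=
  amalgam_l (under_in (iter_amalgam k) \o f k) (g k).

Definition inf_amalgam : groupType := dirlim iter_amalgam_step.

Definition inf_amalgam_in (k : nat) : {multiplicative G k -> inf_amalgam} :=
  dirlim_in iter_amalgam_step k \o under_in (iter_amalgam k).

Lemma inf_amalgam_glue k (x : K k) :
  inf_amalgam_in k (f k x) = inf_amalgam_in k.+1 (g k x).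
Proof.
rewrite /inf_amalgam_in /= dirlim_glue; congr (dirlim_in _ _ _).
exact: amalgam_glue.
Qed.
End IteratedAmalgam.

Definition int_perm :=
  {p : (int -> int) * (int -> int) | `[< cancel p.1 p.2 /\ cancel p.2 p.1 >]}.

HB.instance Definition _ := [isSub of int_perm for @sval _ _].
HB.instance Definition _ := [Choice of int_perm by <:].

Definition IntPerm (p q : int -> int) (pK : cancel p q) (qK : cancel q p) :
  int_perm := exist _ (p, q) (asboolT (conj pK qK)).

Definition ipfun (p : int_perm) : int -> int := (sval p).1.
Definition ipinv (p : int_perm) : int -> int := (sval p).2.
Coercion ipfun : int_perm >-> Funclass.

Lemma ipfunK (p : int_perm) : cancel p (ipinv p).
Proof. by case: p => p pP; case/asboolP: (pP). Qed.
Lemma ipinvK (p : int_perm) : cancel (ipinv p) p.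
Proof. by case: p => p pP; case/asboolP: (pP). Qed.

Lemma int_perm_eq (p q : int_perm) : (p : int -> int) =1 q -> p = q.
Proof.
move=> pq; apply: val_inj; move: (ipfunK p) (ipinvK q); rewrite /ipfun /ipinv.
case: p q pq => -[p p'] /= ? [[q q'] /= ?]; rewrite /ipfun /= => pq pK qK.
by congr (_, _); apply/funext => // i; rewrite -[in LHS](qK i) -pq pK.
Qed.

Definition ip_one : int_perm := @IntPerm id id (fun=> erefl) (fun=> erefl).
Definition ip_mul (p q : int_perm) : int_perm :=
  IntPerm (can_comp (ipfunK p) (ipfunK q)) (can_comp (ipinvK q) (ipinvK p)).
Definition ip_inv (p : int_perm) : int_perm := IntPerm (ipinvK p) (ipfunK p).

Lemma ip_mulA : associative ip_mul.
Proof. by move=> p q r; exact: int_perm_eq. Qed.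
Lemma ip_mul1 : left_id ip_one ip_mul.
Proof. by move=> p; exact: int_perm_eq. Qed.
Lemma ip_mulr1 : right_id ip_one ip_mul.
Proof. by move=> p; exact: int_perm_eq. Qed.
Lemma ip_mulV : left_inverse ip_one ip_inv ip_mul.
Proof. by move=> p; apply: int_perm_eq => i; exact: ipfunK. Qed.
Lemma ip_mulrV : right_inverse ip_one ip_inv ip_mul.
Proof. by move=> p; apply: int_perm_eq => i; exact: ipinvK. Qed.

HB.instance Definition _ :=
  isGroup.Build int_perm ip_mulA ip_mul1 ip_mulr1 ip_mulV ip_mulrV.

Definition swap01 (i : int) : int :=
  if i == 0%R then 1%R else if i == 1%R then 0%R else i.

Lemma swap01K : involutive swap01.
Proof.
rewrite /swap01 => i; case: (eqVneq i 0%R) => [->//|i0].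
by case: (eqVneq i 1%R) => [->//|i1]; rewrite (negPf i0) (negPf i1).
Qed.

Definition transp01 : int_perm := IntPerm swap01K swap01K.
Definition int_shift : int_perm :=
  @IntPerm (fun i : int => i + 1)%R (fun i : int => i - 1)%R
    (@addrK _ 1%R) (@subrK _ 1%R).

Definition gpH : groupType := subgrp (generated [set transp01; int_shift]).

Definition in_interval (i : nat) (j : int) : bool := (- i%:Z <= j <= i%:Z)%R.

Lemma in_intervalS i k j : (i <= k)%N -> in_interval i j -> in_interval k j.
Proof. rewrite /in_interval; lia. Qed.

Definition gpH_on (i : nat) : {pred gpH} := fun h =>
  `[< forall j : int, ~~ in_interval i j -> ipfun (sval h) j = j >].

Lemma gpH_on_mono i k : (i <= k)%N -> {subset gpH_on i <= gpH_on k}.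
Proof.
move=> ik h /asboolP hi; apply/asboolP => j jk; apply: hi.
by apply: contraNN jk; exact: in_intervalS.
Qed.

Lemma gpH_on_mul i : mulg_closed (gpH_on i).
Proof.
move=> g h /asboolP gi /asboolP hi; apply/asboolP => j ji.
by rewrite -[LHS]/(ipfun (sval g) (ipfun (sval h) j)) hi ?gi.
Qed.
Lemma gpH_on_one i : 1 \in gpH_on i.
Proof. exact/asboolP. Qed.
Lemma gpH_on_inv i : invg_closed (gpH_on i).
Proof.
move=> h /asboolP hi; apply/asboolP => j ji.
by rewrite -[LHS]/(ipinv (sval h) j) -[in LHS](hi j ji) ipfunK.
Qed.

HB.instance Definition _ i := isMulClosed.Build gpH (gpH_on i) (@gpH_on_mul i).
HB.instance Definition _ i := isMul1Closed.Build gpH (gpH_on i) (@gpH_on_one i).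
HB.instance Definition _ i := isInvClosed.Build gpH (gpH_on i) (@gpH_on_inv i).

Definition gpH_fin : {pred gpH} := fun h =>
  `[< exists2 i : nat, (0 < i)%N & h \in gpH_on i >].

Lemma gpH_fin_mul : mulg_closed gpH_fin.
Proof.
move=> g h /asboolP[i i0 gi] /asboolP[k k0 hk]; apply/asboolP.
exists (maxn i k); first by rewrite leq_max i0.
apply: gpredM; first exact: gpH_on_mono (leq_maxl _ _) _ gi.
exact: gpH_on_mono (leq_maxr _ _) _ hk.
Qed.
Lemma gpH_fin_one : 1 \in gpH_fin.
Proof. by apply/asboolP; exists 1%N => //; exact: gpred1. Qed.
Lemma gpH_fin_inv : invg_closed gpH_fin.
Proof.
by move=> h /asboolP[i i0 hi]; apply/asboolP; exists i => //; exact: gpredVr.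
Qed.

HB.instance Definition _ := isMulClosed.Build gpH gpH_fin gpH_fin_mul.
HB.instance Definition _ := isMul1Closed.Build gpH gpH_fin gpH_fin_one.
HB.instance Definition _ := isInvClosed.Build gpH gpH_fin gpH_fin_inv.

Definition gpHomega : groupType := subgrp gpH_fin.

(* The multiplicative group {1, -1}: [false] is 1 and [true] is -1. *)
Definition sgn2 := bool.
HB.instance Definition _ := Choice.on sgn2.
HB.instance Definition _ :=
  isGroup.Build sgn2 addbA addFb addbF addbb addbb.

Definition gpV := int -> sgn2.
HB.instance Definition _ := Choice.on gpV.

Definition V_one : gpV := fun=> 1.
Definition V_mul (v w : gpV) : gpV := fun j => v j * w j.
Definition V_inv (v : gpV) : gpV := fun j => (v j)^-1.

Lemma V_mulA : associative V_mul.
Proof. by move=> u v w; apply/funext => j; exact: mulgA. Qed.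
Lemma V_mul1 : left_id V_one V_mul.
Proof. by move=> v; apply/funext => j; exact: mul1g. Qed.
Lemma V_mulr1 : right_id V_one V_mul.
Proof. by move=> v; apply/funext => j; exact: mulg1. Qed.
Lemma V_mulV : left_inverse V_one V_inv V_mul.
Proof. by move=> v; apply/funext => j; exact: mulVg. Qed.
Lemma V_mulrV : right_inverse V_one V_inv V_mul.
Proof. by move=> v; apply/funext => j; exact: mulgV. Qed.

HB.instance Definition _ :=
  isGroup.Build gpV V_mulA V_mul1 V_mulr1 V_mulV V_mulrV.

Definition gpV_on (i : nat) : {pred gpV} := fun v =>
  `[< forall j : int, ~~ in_interval i j -> v j = 1 >].

Lemma gpV_on_mono i k : (i <= k)%N -> {subset gpV_on i <= gpV_on k}.
Proof.
move=> ik v /asboolP vi; apply/asboolP => j jk; apply: vi.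
by apply: contraNN jk; exact: in_intervalS.
Qed.

Lemma gpV_on_mul i : mulg_closed (gpV_on i).
Proof.
move=> v w /asboolP vi /asboolP wi; apply/asboolP => j ji.
by rewrite -[LHS]/(v j * w j) vi ?wi ?mulg1.
Qed.
Lemma gpV_on_one i : 1 \in gpV_on i.
Proof. exact/asboolP. Qed.
Lemma gpV_on_inv i : invg_closed (gpV_on i).
Proof.
move=> v /asboolP vi; apply/asboolP => j ji.
by rewrite -[LHS]/((v j)^-1) vi ?invg1.
Qed.

HB.instance Definition _ i := isMulClosed.Build gpV (gpV_on i) (@gpV_on_mul i).
HB.instance Definition _ i := isMul1Closed.Build gpV (gpV_on i) (@gpV_on_one i).
HB.instance Definition _ i := isInvClosed.Build gpV (gpV_on i) (@gpV_on_inv i).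

Definition act_V (h : gpH) (v : gpV) : gpV := fun j => v (ipfun (sval h^-1) j).

Lemma act_V1 v : act_V 1 v = v. Proof. by []. Qed.
Lemma act_VM g h v : act_V (g * h) v = act_V g (act_V h v). Proof. by []. Qed.
Lemma act_V_mul h v w : act_V h (v * w) = act_V h v * act_V h w.
Proof. by []. Qed.
Lemma act_V_one h : act_V h 1 = 1. Proof. by []. Qed.

Lemma act_V_on i h v : h \in gpH_on i -> v \in gpV_on i -> act_V h v \in gpV_on i.
Proof.
move=> /gpredVr /asboolP hi /asboolP vi; apply/asboolP => j ji.
by rewrite /act_V hi ?vi.
Qed.

(* The semidirect product of V by H; it contains all the groups
   G_i' = V_i ><| H_i, compatibly with the inclusions of V_i in V_(i+1) and of
   H_i in H_(i+1). *)
Definition gpVH := (gpV * gpH)%type.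
HB.instance Definition _ := Choice.on gpVH.

Definition VH_one : gpVH := (1, 1).
Definition VH_mul (x y : gpVH) : gpVH := (x.1 * act_V x.2 y.1, x.2 * y.2).
Definition VH_inv (x : gpVH) : gpVH := (act_V x.2^-1 x.1^-1, x.2^-1).

Lemma VH_mulA : associative VH_mul.
Proof.
move=> [u f] [v g] [w h].
by rewrite /VH_mul /= act_V_mul act_VM !mulgA.
Qed.
Lemma VH_mul1 : left_id VH_one VH_mul.
Proof. by move=> [v h]; rewrite /VH_mul /VH_one /= (act_V1 v) !mul1g. Qed.
Lemma VH_mulr1 : right_id VH_one VH_mul.
Proof. by move=> [v h]; rewrite /VH_mul /VH_one /= act_V_one !mulg1. Qed.
Lemma VH_mulV : left_inverse VH_one VH_inv VH_mul.
Proof.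
by move=> [v h]; congr pair; [rewrite /= -act_V_mul mulVg|exact: mulVg h].
Qed.
Lemma VH_mulrV : right_inverse VH_one VH_inv VH_mul.
Proof.
move=> [v h]; congr pair; last exact: mulgV h.
by rewrite /= -(act_VM h h^-1 v^-1) (mulgV h); exact: mulgV v.
Qed.

HB.instance Definition _ :=
  isGroup.Build gpVH VH_mulA VH_mul1 VH_mulr1 VH_mulV VH_mulrV.

Definition in_gpG (i : nat) : {pred gpVH} := fun x =>
  (x.1 \in gpV_on i) && (x.2 \in gpH_on i).

Lemma in_gpG_mul i : mulg_closed (in_gpG i).
Proof.
move=> x y /andP[x1 x2] /andP[y1 y2]; apply/andP; split; last exact: gpredM.
by apply: gpredM => //; exact: act_V_on.
Qed.
Lemma in_gpG_one i : 1 \in in_gpG i.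
Proof. by apply/andP; split; exact: gpred1. Qed.
Lemma in_gpG_inv i : invg_closed (in_gpG i).
Proof.
move=> x /andP[x1 x2]; apply/andP; split; last exact: gpredVr.
by apply: act_V_on; exact: gpredVr.
Qed.

HB.instance Definition _ i := isMulClosed.Build gpVH (in_gpG i) (@in_gpG_mul i).
HB.instance Definition _ i := isMul1Closed.Build gpVH (in_gpG i) (@in_gpG_one i).
HB.instance Definition _ i := isInvClosed.Build gpVH (in_gpG i) (@in_gpG_inv i).

Definition gpG (i : nat) : groupType := subgrp (in_gpG i).

Definition z_ (i : nat) : gpV := fun j => (in_interval i j : sgn2).

Lemma z_V i v : v \in generated [set z_ i] -> v \in gpV_on i.
Proof.
move=> /asboolP; apply=> _ ->; apply/asboolP => j /negPf ji.
by rewrite /z_ ji.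
Qed.

Lemma z_central i (h : gpH) : h \in gpH_on i -> act_V h (z_ i) = z_ i.
Proof.
move=> hi; apply/funext => j; rewrite /act_V /z_.
have inj (g : gpH) (k : int) : g \in gpH_on i ->
    in_interval i (ipfun (sval g) k) -> in_interval i k.
  move=> /asboolP gi; case: (boolP (in_interval i k)) => // ki.
  by rewrite gi // (negPf ki).
apply/idP/idP; first exact/inj/gpredVr.
by move=> ji; apply: (inj h) => //; rewrite -[ipfun _ _]/(ipfun _ (ipinv _ _)) ipinvK.
Qed.

Lemma generated_z_central i (h : gpH) v :
  h \in gpH_on i -> v \in generated [set z_ i] -> act_V h v = v.
Proof.
move=> hi /asboolP; pose fixed := fun v : gpV => `[< act_V h v = v >].
have fM : mulg_closed fixed.
  move=> u w /asboolP uh /asboolP wh; apply/asboolP.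
  by rewrite act_V_mul uh wh.
have f1 : 1 \in fixed by apply/asboolP; exact: act_V_one.
have fV : invg_closed fixed.
  move=> u /asboolP uh; apply/asboolP.
  by rewrite -[LHS]/((act_V h u)^-1) uh.
pose S : groupClosed gpV := HB.pack fixed
  (isMulClosed.Build gpV fixed fM) (isMul1Closed.Build gpV fixed f1)
  (isInvClosed.Build gpV fixed fV).
move=> /(_ S) vS; apply/asboolP; apply: vS => _ ->.
by apply/asboolP; exact: z_central.
Qed.

(* K_i = <z_i> x H_i, as a subset of V ><| H. *)
Definition in_gpK (i : nat) : {pred gpVH} := fun x =>
  (x.1 \in generated [set z_ i]) && (x.2 \in gpH_on i).

Lemma in_gpK_mul i : mulg_closed (in_gpK i).
Proof.
move=> x y /andP[x1 x2] /andP[y1 y2]; apply/andP; split; last exact: gpredM.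
by apply: gpredM => //; rewrite (generated_z_central x2 y1).
Qed.
Lemma in_gpK_one i : 1 \in in_gpK i.
Proof. by apply/andP; split; exact: gpred1. Qed.
Lemma in_gpK_inv i : invg_closed (in_gpK i).
Proof.
move=> x /andP[x1 x2]; apply/andP; split; last exact: gpredVr.
by rewrite /= (generated_z_central (gpredVr _ x2) (gpredVr _ x1)); exact: gpredVr.
Qed.

HB.instance Definition _ i := isMulClosed.Build gpVH (in_gpK i) (@in_gpK_mul i).
HB.instance Definition _ i := isMul1Closed.Build gpVH (in_gpK i) (@in_gpK_one i).
HB.instance Definition _ i := isInvClosed.Build gpVH (in_gpK i) (@in_gpK_inv i).

Definition gpK (i : nat) : groupType := subgrp (in_gpK i).

Lemma in_gpK_G i : {subset in_gpK i <= in_gpG i}.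
Proof. by move=> x /andP[x1 x2]; apply/andP; split => //; exact: z_V. Qed.

Lemma in_gpK_GS i : {subset in_gpK i <= in_gpG i.+1}.
Proof.
move=> x /in_gpK_G /andP[x1 x2]; apply/andP; split.
  exact: gpV_on_mono (leqnSn i) _ x1.
exact: gpH_on_mono (leqnSn i) _ x2.
Qed.

Definition gpK_G (i : nat) : {multiplicative gpK i -> gpG i} :=
  subgrp_incl (@in_gpK_G i).
Definition gpK_GS (i : nat) : {multiplicative gpK i -> gpG i.+1} :=
  subgrp_incl (@in_gpK_GS i).

(* [gpP m] is [G_1 *_(K_1) ... *_(K_m) G_(m+1)]. *)
Definition gpP_under (m : nat) : grp_under (gpG m.+1) :=
  iter_amalgam (G := fun k => gpG k.+1) (K := fun k => gpK k.+1)
    (fun k => gpK_G k.+1) (fun k => gpK_GS k.+1) m.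
Definition gpP (m : nat) : groupType := gpP_under m.
Definition gpP_in (m : nat) : {multiplicative gpG m.+1 -> gpP m} :=
  under_in (gpP_under m).

(* [gpQ n] is [G_(n+1) *_(K_(n+1)) G_(n+2) *_(K_(n+2)) ...]. *)
Definition gpQ (n : nat) : groupType :=
  inf_amalgam (G := fun k => gpG (k + n.+1)) (K := fun k => gpK (k + n.+1))
    (fun k => gpK_G (k + n.+1)) (fun k => gpK_GS (k + n.+1)).
Definition gpQ_in (n k : nat) : {multiplicative gpG (k + n.+1) -> gpQ n} :=
  inf_amalgam_in (G := fun k => gpG (k + n.+1)) (K := fun k => gpK (k + n.+1))
    (fun k => gpK_G (k + n.+1)) (fun k => gpK_GS (k + n.+1)) k.

Lemma gpQ_glue n k (x : gpK (k + n.+1)) :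
  gpQ_in n k (gpK_G _ x) = gpQ_in n k.+1 (gpK_GS _ x).
Proof. exact: inf_amalgam_glue. Qed.

Lemma in_gpK_H i (h : gpH) : h \in gpH_on i -> ((1, h) : gpVH) \in in_gpK i.
Proof. by move=> hi; apply/andP; split => //; exact: gpred1. Qed.

Definition gpH_K (i : nat) (h : gpH) (hi : h \in gpH_on i) : gpK i :=
  exist _ (1, h) (in_gpK_H hi).

Definition gpH_Q (n k : nat) (h : gpH) (hk : h \in gpH_on (k + n.+1)) : gpQ n :=
  gpQ_in n k (gpK_G _ (gpH_K hk)).

Lemma gpH_Q_indep n k l h (hk : h \in gpH_on (k + n.+1))
  (hl : h \in gpH_on (l + n.+1)) : gpH_Q hk = gpH_Q hl.
Proof.
wlog kl : k l hk hl / (k <= l)%N => [W|].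
  by case/orP: (leq_total k l) => ?; [exact: W|apply/esym; exact: W].
elim: l kl hk hl => [|l IH] kl hk hl.
  by move: hk hl; rewrite leqn0 in kl; rewrite (eqP kl) => hk hl;
    rewrite (bool_irrelevance hk hl).
move: kl; rewrite leq_eqVlt ltnS => /predU1P[kl|kl].
  by move: hk; rewrite kl => hk; rewrite (bool_irrelevance hk hl).
have hl' : h \in gpH_on (l + n.+1).
  by apply: gpH_on_mono hk; rewrite leq_add2r.
rewrite (IH kl hk hl') /gpH_Q gpQ_glue; congr (gpQ_in _ _ _).
exact: val_inj.
Qed.

Lemma gpH_fin_level n (h : gpHomega) :
  exists k, sval h \in gpH_on (k + n.+1).
Proof.
case: h => h /= /asboolP[i i0 hi]; exists i.
by apply: gpH_on_mono hi; exact: leq_addr.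
Qed.

(* The copy of H_i in Q_n lies in G_i, for any i > n; by [gpH_Q_indep] the
   choice of i is immaterial. *)
Definition gpHomega_Q_fun (n : nat) (h : gpHomega) : gpQ n :=
  gpH_Q (xchooseP (gpH_fin_level n h)).

Lemma gpHomega_QM n : {morph gpHomega_Q_fun n : x y / x * y}.
Proof.
move=> x y; rewrite /gpHomega_Q_fun.
set hx := xchooseP (gpH_fin_level n x); set hy := xchooseP (gpH_fin_level n y).
set hxy := xchooseP _; move: hx hy hxy.
move: (xchoose _) (xchoose _) (xchoose _) => k j i hx hy hxy.
have hx' : sval x \in gpH_on (maxn i j + n.+1).
  by apply: gpH_on_mono hx; rewrite leq_add2r leq_maxl.
have hy' : sval y \in gpH_on (maxn i j + n.+1).
  by apply: gpH_on_mono hy; rewrite leq_add2r leq_maxr.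
rewrite (gpH_Q_indep hx hx') (gpH_Q_indep hy hy').
rewrite (gpH_Q_indep hxy (gpredM _ _ hx' hy')) /gpH_Q -!gmulfM.
congr (gpQ_in _ _ (gpK_G _ _)); by apply: val_inj; congr pair.
Qed.

HB.instance Definition _ n :=
  isMultiplicative.Build gpHomega (gpQ n) (gpHomega_Q_fun n) (@gpHomega_QM n).

Definition gpHomega_Q (n : nat) : {multiplicative gpHomega -> gpQ n} :=
  gpHomega_Q_fun n.
Definition gpHomega_H : {multiplicative gpHomega -> gpH} :=
  (@subgrp_val gpH gpH_fin : {multiplicative subgrp gpH_fin -> gpH}).

(* J_n = Q_n *_(H_omega) H *)
Definition gpJ (n : nat) : groupType := amalgam (gpHomega_Q n) gpHomega_H.

Definition gpK_P (m : nat) : {multiplicative gpK m.+1 -> gpP m} :=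
  gpP_in m \o gpK_G m.+1.
Definition gpK_J (n : nat) : {multiplicative gpK n -> gpJ n} :=
  amalgam_l (gpHomega_Q n) gpHomega_H \o (gpQ_in n 0 \o gpK_GS n).

(* Dunwoody's group, split at n = m.+1:
   G_1 *_(K_1) ... *_(K_(n-1)) G_n *_(K_n) J_n.
   Up to isomorphism it does not depend on n. *)
Definition dunwoody (m : nat) : groupType := amalgam (gpK_P m) (gpK_J m.+1).

(* Main.v *)
Require Import Defs.
From HB Require Import structures.
From mathcomp Require Import all_boot all_order all_algebra.
From mathcomp Require Import all_classical all_reals all_analysis.
From mathcomp Require Import zify lra.

(** Suppose that [J] acts acylindrically on a hyperbolic space so that every
    generalized loxodromic element is loxodromic. A finite group [F] of
    isometries almost fixes a point [x], up to a constant that depends only on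
    the space. If [F] commutes with a loxodromic element [g], then it almost
    fixes all the points [g ^+ k x] as well, and these go to infinity; so
    acylindricity bounds the order of [F] independently of [g]
    ([no_universal_acylindrical_action]). It remains to find generalized
    loxodromic elements of [J] that commute with arbitrarily large finite
    subgroups.

    For every [n] the group [J] is the amalgam of [P_n], the part generated by
    [G_1, ..., G_(n+1)], and [J_(n+1)] over the finite group [K_(n+1)]. The
    action on the Bass-Serre tree of such a splitting is acylindrical, and the
    product of an element of each factor outside the amalgamated subgroup is
    loxodromic ([amalgam_generalized_loxodromic]). The element [z_n] of
    [G_(n+1)] is not in [K_(n+1)], because it is not constant on
    [[-n-1, n+1]], and the central element [z_(n+2)] of [G_(n+2)] is not in
    [K_(n+1)], because its support is too large. Both are invariant under
    permutations of [[-n, n]], so [z_n z_(n+2)] is a generalized loxodromic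
    element that commutes with [H_n], the order of which goes to infinity.

    Three constructions support this. That [J] can be split at every [n] follows
    from a universal property that does not mention [n]: a homomorphism from [J]
    is a compatible family of homomorphisms from the [G_i] and [H]
    ([dunwoody_lift], [dunwoody_hom_ext]). The Bass-Serre tree appears through
    its set of edges, encoded as normal forms of cosets, with an explicit
    action and an explicit invariant metric. Finally, a hyperbolic space has to
    be geodesic: a group with an invariant metric that satisfies the four-point
    condition of trees is embedded in a real tree whose points are the functions
    that measure the distance to a point of a segment ([rtree]). *)

Set Implicit Arguments.
Unset Strict Implicit.
Unset Printing Implicit Defensive.

Import Order.TTheory GRing.Theory Num.Theory.
Local Open Scope classical_set_scope.
Local Open Scope ring_scope.

(** * Homomorphisms and generalized loxodromic elements *)

Section Homomorphisms.
Local Open Scope group_scope.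

Lemma mult1 (G H : groupType) (f : {multiplicative G -> H}) : f 1 = 1.
Proof. by apply: (mulgI (f 1)); rewrite -gmulfM !mulg1. Qed.

Lemma multV (G H : groupType) (f : {multiplicative G -> H}) (x : G) :
  f x^-1 = (f x)^-1.
Proof. by apply: (mulgI (f x)); rewrite -gmulfM !mulgV mult1. Qed.

Lemma generalized_loxodromic_inj (R : realType) (G T : groupType)
    (phi : {multiplicative G -> T}) (x : G) :
  injective phi -> generalized_loxodromic R (phi x) -> generalized_loxodromic R x.
Proof.
move=> phi_inj [X [a [hX acyl [s sP]]]].
have a1 p : a (phi 1) p = p by rewrite mult1 act1.
have aM y z p : a (phi (y * z)) p = a (phi y) (a (phi z) p) by rewrite gmulfM actM.
pose b : isom_action G X := IsomAction a1 aM (fun y => act_isom a (phi y)).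
exists X, b; split=> //.
  move=> eps /acyl[M [N [M0 MN]]]; exists M, N; split=> // p q /MN.
  apply: card_le_trans.
  rewrite -(card_le_eql (inj_card_eq (f := phi) _)); last exact: in2W phi_inj.
  by apply: subset_card_le => _ [y yP <-].
exists s; suff zE (n : int) : phi (zpow x n) = zpow (phi x) n.
  by rewrite (_ : (fun n => b _ s) = (fun n => a (zpow (phi x) n) s)) //;
    apply/funext => n; rewrite /= zE.
have phiX k : phi (x ^+ k) = phi x ^+ k.
  by elim: k => [|k IH]; [exact: mult1|rewrite !expgS gmulfM IH].
by case: n => k /=; rewrite ?multV phiX.
Qed.

End Homomorphisms.

(** * Finite groups commuting with a loxodromic element *)

Lemma hyperbolic_four_point (R : realType) (X : metricType R) :
  hyperbolic X -> exists2 delta : R, 0 <= delta & forall x y z w : X,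
    mdist x z + mdist y w
      <= Num.max (mdist x y + mdist z w) (mdist y z + mdist x w) + delta.
Proof.
move=> [_ [delta dP]]; exists (2 * `|delta|); first by rewrite mulr_ge0.
move=> x y z w; have := dP w x y z; rewrite /gromov_product.
have := ler_norm delta.
rewrite minEle maxEle; case: ifP => ?; case: ifP => ?; lra.
Qed.

Lemma finite_set_ubound (R : realType) (T : Type) (A : set T) (u : T -> R) :
  finite_set A -> exists b, forall x, A x -> u x <= b.
Proof.
elim/Pchoice: T => T in A u *.
move=> /finite_seqP[s ->]; elim: s => [|x s [b bP]]; first by exists 0.
exists (Num.max (u x) b) => y; rewrite /= inE => /predU1P[->|ys].
  by rewrite le_max lexx.
by rewrite le_max bP ?orbT.
Qed.

(** A finite group of isometries moves a point by a bounded amount: take the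
    center [x] of an almost minimal ball containing an orbit. All translates of
    [x] are centers of balls with the same radius, and if [x] and [f x] were far
    apart then the midpoint between them would do strictly better. *)
Lemma finite_group_almost_fixed (R : realType) (X : metricType R)
    (G : groupType) (a : isom_action G X) (delta : R) (F : set G) (s : X) :
    geodesic X ->
    (forall x y z w : X, mdist x z + mdist y w
      <= Num.max (mdist x y + mdist z w) (mdist y z + mdist x w) + delta) ->
    finite_set F -> F !=set0 ->
    (forall x y, F x -> F y -> F (x^-1 * y)%g) ->
  exists x : X, forall f, F f -> mdist x (a f x) <= 2 + 2 * delta.
Proof.
move=> geo hyp finF [f0 Ff0] FV.
pose rad : set R := [set r | exists x, forall f, F f -> mdist x (a f s) <= r].
have rad0 : rad !=set0.
  have [b bP] := finite_set_ubound (fun f => mdist s (a f s)) finF.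
  by exists b, s => f Ff; exact: bP.
have radlb : lbound rad 0.
  move=> r [x xP]; exact: le_trans (mdist_ge0 _ _) (xP _ Ff0).
have hinf : has_inf rad by split => //; exists 0.
have [r [x xP] rlt] := inf_adherent ltr01 hinf.
exists x => f Ff.
have fxP h : F h -> mdist (a f x) (a h s) <= r.
  move=> Fh; have := xP _ (FV _ _ Ff Fh).
  by rewrite -(act_isom a f) -actM mulVKg.
have [c [c0 cD cd]] := geo x (a f x).
set D := mdist x (a f x) in cD cd *.
have D0 : 0 <= D by exact: mdist_ge0.
pose p := c (D / 2).
have xp : mdist x p = D / 2.
  rewrite -c0 cd ?in_itv /= ?lexx //; last by rewrite divr_ge0 //=; lra.
  by rewrite sub0r normrN ger0_norm // divr_ge0.
have pf : mdist (a f x) p = D / 2.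
  rewrite -cD cd ?in_itv /= ?lexx ?andbT //; last by rewrite divr_ge0 //=; lra.
  by rewrite ger0_norm; lra.
have : rad (r + delta - D / 2).
  exists p => h Fh; have := hyp x p (a f x) (a h s).
  rewrite -/D xp (metric_sym p (a f x)) pf; have := xP _ Fh; have := fxP _ Fh.
  by rewrite maxEle; case: ifP => ?; lra.
move=> /(ge_inf (ex_intro _ 0 radlb)); lra.
Qed.

Lemma loxodromic_unbounded (R : realType) (X : metricType R) (G : groupType)
    (a : isom_action G X) (g : G) (x : X) (M : R) :
  loxodromic a g -> exists n : nat, M <= mdist x (a (g ^+ n)%g x).
Proof.
move=> [s [lam [c [lam1 c0 qi]]]].
have lam0 : 0 < lam by lra.
pose B := lam * (c + M + 2 * mdist x s).
set k := Num.bound `|B|; exists k.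
have /andP[+ _] := qi 0%R (Posz k).
rewrite sub0r normrN /= expg0 act1.
have -> : (`|Posz k|%:~R = k%:R :> R) by [].
set b := k%:R; have Bb : B <= b.
  exact: le_trans (ler_norm _) (ltW (archi_boundP (normr_ge0 B))).
have : lam^-1 * B <= lam^-1 * b by rewrite ler_pM2l ?invr_gt0.
rewrite {1}/B mulKf ?gt_eqF // => Mb.
have := metric_triangle s x (a (g ^+ k)%g s).
have := metric_triangle x (a (g ^+ k)%g x) (a (g ^+ k)%g s).
rewrite act_isom (metric_sym s x); lra.
Qed.

(** The point [x] almost fixed by [F] has all its translates [g ^+ n x] almost
    fixed by [F] as well, and they go to infinity, so acylindricity bounds the
    size of [F], in terms of the action only. *)
Theorem no_universal_acylindrical_action (R : realType) (G : groupType) :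
    (forall N : nat, exists (g : G) (F : set G),
      [/\ generalized_loxodromic R g, finite_set F, ~ (F #<= `I_N)%card,
          (forall x y, F x -> F y -> F (x^-1 * y)%g)
        & (forall x, F x -> commute x g)]) ->
  ~ has_universal_acylindrical_action R G.
Proof.
move=> big [X [a [hX acyl univ]]].
have [geo _] := hX; have [delta delta0 hyp] := hyperbolic_four_point hX.
have [|M [N [M0 MN]]] := acyl (2 + 2 * delta); first by lra.
have [g [F [genl finF nF FV Fg]]] := big N.
have lox := univ _ genl; have [s _] := lox.
have F0 : F !=set0.
  apply/set0P/eqP => F0; apply: nF.
  by rewrite F0 card_ge0.
have [x xP] := finite_group_almost_fixed a s geo hyp finF F0 FV.
have [n nM] := loxodromic_unbounded x M lox.
apply: nF; apply: card_le_trans (MN _ _ nM).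
apply: subset_card_le => f Ff /=; split; first exact: xP.
have fg : (f * g ^+ n)%g = (g ^+ n * f)%g by exact: commuteX (Fg _ Ff).
by rewrite -actM fg actM act_isom; exact: xP.
Qed.

(** * The real tree spanned by an invariant tree-like pseudometric *)

(** A left-invariant pseudometric on [G] satisfying the four-point condition
    that characterizes the subsets of real trees. *)
Record tree_pseudometric (R : realType) (G : groupType) := TreePseudometric {
  tdist :> G -> G -> R;
  tdist_refl : forall x, tdist x x = 0;
  tdist_sym : forall x y, tdist x y = tdist y x;
  tdist_four : forall x y z w, tdist x z + tdist y w
    <= Num.max (tdist x y + tdist z w) (tdist y z + tdist x w);
  tdist_mul : forall g x y, tdist (g * x)%g (g * y)%g = tdist x y }.

Section Span.
Variables (R : realType) (G : groupType) (d : tree_pseudometric R G).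
Implicit Types (x y z u v w : G) (s t : R) (p q : G -> R).

Let dxx := tdist_refl d.
Let dC := tdist_sym d.

Lemma tdist_triangle y x z : d x z <= d x y + d y z.
Proof. by have := tdist_four d x y z y; rewrite dxx (dC z y) (addrC (d y z)) maxxx addr0. Qed.

Lemma tdist_ge0 x y : 0 <= d x y.
Proof. by have := tdist_triangle y x x; rewrite dxx (dC y x); lra. Qed.

(** In a tree this is the distance to the point of [[x, y]] at distance [t] from
    [x]; points of the real tree are represented by these functions, so that
    the action and the equality of points do not involve [x], [y] and [t]. *)
Definition seg x y t : G -> R := fun v => Num.max (d v x - t) (d v y - (d x y - t)).

Definition on_seg p x y := exists2 t, 0 <= t <= d x y & p = seg x y t.

Lemma seg_rev x y t : seg x y t = seg y x (d x y - t).
Proof. by apply/funext => v; rewrite /seg maxC (dC y x) subKr. Qed.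

Lemma on_segC p x y : on_seg p x y -> on_seg p y x.
Proof.
by move=> [t tP ->]; exists (d x y - t); [rewrite (dC y x); lra|exact: seg_rev].
Qed.

(** The bound on [t] says that the segments from [x] to [y] and from [x] to [z]
    have not branched yet at distance [t]. *)
Lemma seg_branch x y z t : 2 * t <= d x y + d x z - d y z -> seg x y t = seg x z t.
Proof.
have key (y1 z1 : G) : 2 * t <= d x y1 + d x z1 - d y1 z1 ->
    forall v, seg x z1 t v <= seg x y1 t v.
  move=> tle v; rewrite /seg ge_max le_max lexx /=.
  have := tdist_four d v x z1 y1; rewrite (dC z1 y1).
  rewrite !maxEle; case: ifP => ?; case: ifP => ?; lra.
move=> tle; apply/funext => v; apply/eqP; rewrite eq_le key ?key //.
by rewrite (dC z y); lra.
Qed.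

Lemma on_seg_third p x y z : on_seg p x y -> on_seg p x z \/ on_seg p z y.
Proof.
move=> [t tP ->]; have := tdist_triangle y x z; have := tdist_triangle x y z.
have := tdist_triangle z x y; rewrite (dC y x) (dC z y) => h1 h2 h3.
have [tle|tgt] := leP (2 * t) (d x y + d x z - d y z).
  left; exists t; [lra|exact: seg_branch].
right; apply: on_segC; exists (d x y - t); first by lra.
by rewrite seg_rev; apply: seg_branch; rewrite (dC y x) (dC x z) in tgt *; lra.
Qed.

(** Two points always lie on a common segment between elements of [G]: this
    reduces every metric question about two points to an interval. *)
Lemma on_seg_common p q x y x' y' : on_seg p x y -> on_seg q x' y' ->
  exists u w, on_seg p u w /\ on_seg q u w.
Proof.
have aux z : on_seg p z x' -> on_seg q x' y' ->
    exists u w, on_seg p u w /\ on_seg q u w.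
  move=> pz qP.
  have [pz'|px'] := on_seg_third y' pz; last first.
    by exists x', y'; split => //; exact: on_segC.
  have [qz|qz] := on_seg_third z qP.
    by exists z, x'; split => //; exact: on_segC.
  by exists z, y'.
by case/(on_seg_third x') => [|/on_segC]; exact: aux.
Qed.

Definition pdist p q : R := sup [set `|p v - q v| | v in setT].

Lemma seg_start x y t : 0 <= t -> seg x y t x = t.
Proof. by move=> t0; rewrite /seg dxx maxEle; case: ifP => ?; lra. Qed.

Lemma seg_lip x y s t v : `|seg x y s v - seg x y t v| <= `|s - t|.
Proof.
have [st|ts] := leP s t; [rewrite (ler0_norm (_ : s - t <= 0))|
    rewrite (gtr0_norm (_ : 0 < s - t))]; try lra;
  rewrite /seg !maxEle ler_norml; case: ifP => ?; case: ifP => ?; lra.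
Qed.

Lemma pdist_seg x y s t : 0 <= s -> 0 <= t -> pdist (seg x y s) (seg x y t) = `|s - t|.
Proof.
move=> s0 t0; apply/eqP; rewrite eq_le; apply/andP; split.
  apply: ge_sup; first by exists `|seg x y s x - seg x y t x|, x.
  by move=> _ [v _ <-]; exact: seg_lip.
apply: ub_le_sup; first by exists `|s - t| => _ [v _ <-]; exact: seg_lip.
by exists x => //; rewrite !seg_start.
Qed.

Definition rtree := {p : G -> R | `[< exists x y, on_seg p x y >]}.
HB.instance Definition _ := [isSub of rtree for @sval _ _].
HB.instance Definition _ := [Choice of rtree by <:].

Lemma rtree_seg x y t : 0 <= t <= d x y -> `[< exists x' y', on_seg (seg x y t) x' y' >].
Proof. by move=> tP; apply/asboolP; exists x, y, t. Qed.

Definition rseg x y t (tP : 0 <= t <= d x y) : rtree := exist _ (seg x y t) (rtree_seg tP).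

Definition rdist (p q : rtree) : R := pdist (sval p) (sval q).

Lemma rtree_pair (p q : rtree) : exists x y s t,
  [/\ 0 <= s <= d x y, 0 <= t <= d x y, s <= t, sval p = seg x y s & sval q = seg x y t].
Proof.
case: p q => p /= /asboolP[x [y pP]] [q /= /asboolP[x' [y' qP]]].
have [u [w [[s sP ->] [t tP ->]]]] := on_seg_common pP qP.
have [st|ts] := leP s t; first by exists u, w, s, t.
exists w, u, (d u w - s), (d u w - t); rewrite (dC w u).
by split; [lra|lra|lra|exact: seg_rev|exact: seg_rev].
Qed.

Lemma rdist_ler (p q : rtree) v : `|sval p v - sval q v| <= rdist p q.
Proof.
have [x [y [s [t [sP tP st pE qE]]]]] := rtree_pair p q.
rewrite /rdist pE qE pdist_seg; [exact: seg_lip|lra|lra].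
Qed.

Lemma rdistxx (p : rtree) : rdist p p = 0.
Proof.
have [x [y [s [_ [sP _ _ pE _]]]]] := rtree_pair p p.
by rewrite /rdist pE pdist_seg ?subrr ?normr0 //; lra.
Qed.

Lemma rdist_eq0 (p q : rtree) : rdist p q = 0 -> p = q.
Proof.
move=> pq; apply: val_inj; apply/funext => v; apply/eqP; rewrite -subr_eq0.
by rewrite -normr_le0 -pq rdist_ler.
Qed.

Lemma rdistC (p q : rtree) : rdist p q = rdist q p.
Proof.
rewrite /rdist /pdist; congr sup; apply/seteqP.
by split => _ [v _ <-]; exists v; rewrite // distrC.
Qed.

Lemma rdist_triangle (q p r : rtree) : rdist p r <= rdist p q + rdist q r.
Proof.
apply: ge_sup; first by exists `|sval p 1%g - sval r 1%g|, 1%g.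
move=> _ [v _ <-]; apply: le_trans (lerD (rdist_ler p q v) (rdist_ler q r v)).
exact: ler_distD.
Qed.

HB.instance Definition _ :=
  isMetric.Build R rtree rdistxx rdist_eq0 rdistC rdist_triangle.

Lemma mdist_rtree (p q : rtree) : mdist p q = pdist (sval p) (sval q).
Proof. by []. Qed.

Lemma rvertex_subproof x : 0 <= (0 : R) <= d x x. Proof. by rewrite dxx lexx. Qed.
Definition rvertex x : rtree := rseg (rvertex_subproof x).

Lemma rvertex_start x y : sval (rvertex x) = seg x y 0.
Proof. by apply: seg_branch; rewrite dxx; lra. Qed.

Lemma rvertex_end x y : sval (rvertex y) = seg x y (d x y).
Proof. by rewrite seg_rev subrr -rvertex_start. Qed.

Lemma rvertex_between x y v : d x v + d v y = d x y -> sval (rvertex v) = seg x y (d x v).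
Proof.
by move=> vP; rewrite (rvertex_end x v); apply: seg_branch; lra.
Qed.

Lemma mdist_rvertex x y : mdist (rvertex x) (rvertex y) = d x y.
Proof.
rewrite mdist_rtree (rvertex_start x y) (rvertex_end x y).
by rewrite pdist_seg ?tdist_ge0 // sub0r normrN ger0_norm ?tdist_ge0.
Qed.

Lemma mdist_start x y t (p : rtree) :
  0 <= t -> sval p = seg x y t -> mdist (rvertex x) p = t.
Proof.
move=> t0 pE; rewrite mdist_rtree (rvertex_start x y) pE pdist_seg //.
by rewrite sub0r normrN ger0_norm.
Qed.

Lemma mdist_end x y t (p : rtree) :
  0 <= t <= d x y -> sval p = seg x y t -> mdist p (rvertex y) = d x y - t.
Proof.
move=> tP pE; rewrite mdist_rtree (rvertex_end x y) pE pdist_seg ?tdist_ge0 //; last lra.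
by rewrite ler0_norm; lra.
Qed.

(** Any two points [p], [q] have vertices [x], [y] beyond them, and applying the
    four-point condition to such vertices gives it for the points. *)
Lemma rtree_four (p q r s : rtree) : mdist p r + mdist q s
  <= Num.max (mdist p q + mdist r s) (mdist q r + mdist p s).
Proof.
have ext (a b : rtree) : exists x y,
    d x y = mdist (rvertex x) a + mdist a b + mdist b (rvertex y).
  have [x [y [i [j [iP jP ij aE bE]]]]] := rtree_pair a b; exists x, y.
  rewrite (mdist_start _ aE) 1?(mdist_end jP bE); last lra.
  rewrite mdist_rtree aE bE pdist_seg; [|lra|lra].
  by rewrite ler0_norm; lra.
have [x [y xyE]] := ext p r; have [z [w zwE]] := ext q s.
have step (u v : G) (a b : rtree) :
    d u v <= mdist (rvertex u) a + mdist a b + mdist b (rvertex v).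
  rewrite -mdist_rvertex -addrA.
  by apply: le_trans (metric_triangle _ a _) _; rewrite lerD2l metric_triangle.
have := tdist_four d x z y w.
have := step x z p q; have := step y w r s; have := step z y q r; have := step x w p s.
rewrite (metric_sym (rvertex y) r) (metric_sym q (rvertex z)).
by rewrite !maxEle; case: ifP => ?; case: ifP => ?; lra.
Qed.

Lemma rtree_hyperbolic : hyperbolic rtree.
Proof.
split; last first.
  exists 0 => w x y z; have := rtree_four x y z w; rewrite /gromov_product.
  by rewrite minEle maxEle; case: ifP => ?; case: ifP => ?; lra.
move=> p q; have [x [y [s [t [sP tP st pE qE]]]]] := rtree_pair p q.
have pq : mdist p q = t - s.
  by rewrite mdist_rtree pE qE pdist_seg; [rewrite ler0_norm; lra|lra|lra].
pose c (i : R) : rtree := if pselect (0 <= s + i <= d x y) is left iP then rseg iP else p.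
have cE i : 0 <= s + i <= d x y -> sval (c i) = seg x y (s + i).
  by rewrite /c => iP; case: pselect.
exists c; split.
- by apply: val_inj; rewrite /= cE addr0.
- by apply: val_inj; rewrite /= cE pq; [rewrite qE subrKC|lra].
- rewrite pq => i j; rewrite !in_itv /= => iP jP.
  rewrite mdist_rtree !cE; [|lra|lra].
  by rewrite pdist_seg; [congr (`|_|); lra|lra|lra].
Qed.

Lemma seg_translate g x y t v : seg (g * x)%g (g * y)%g t (g * v)%g = seg x y t v.
Proof. by rewrite /seg !tdist_mul. Qed.

Lemma rtree_act_subproof g (p : rtree) :
  `[< exists x y, on_seg (fun v => sval p (g^-1 * v)%g) x y >].
Proof.
case: p => p /= /asboolP[x [y [t tP ->]]]; apply/asboolP.
exists (g * x)%g, (g * y)%g, t; first by rewrite tdist_mul.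
by apply/funext => v; rewrite -(seg_translate g) mulVKg.
Qed.

Definition rtree_act g (p : rtree) : rtree :=
  exist _ (fun v => sval p (g^-1 * v)%g) (rtree_act_subproof g p).

Lemma rtree_act1 (p : rtree) : rtree_act 1%g p = p.
Proof. by apply: val_inj; apply/funext => v /=; rewrite invg1 mul1g. Qed.

Lemma rtree_actM g h (p : rtree) : rtree_act (g * h)%g p = rtree_act g (rtree_act h p).
Proof. by apply: val_inj; apply/funext => v /=; rewrite invgM mulgA. Qed.

Lemma rtree_act_isom g (p q : rtree) : mdist (rtree_act g p) (rtree_act g q) = mdist p q.
Proof.
rewrite !mdist_rtree /pdist; congr sup; apply/seteqP; split => _ [v _ <-].
  by exists (g^-1 * v)%g.
by exists (g * v)%g => //=; rewrite mulKg.
Qed.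

Definition rtree_action : isom_action G rtree :=
  IsomAction rtree_act1 rtree_actM rtree_act_isom.

Lemma rtree_act_vertex g x : rtree_action g (rvertex x) = rvertex (g * x)%g.
Proof.
apply: val_inj; apply/funext => v /=.
by rewrite -(seg_translate g) mulVKg.
Qed.

End Span.

(** * Acylindricity when edge stabilizers are finite *)

Lemma zpow_addn (G : groupType) (g : G) (m : int) (k : nat) :
  zpow g (m + k%:Z) = (zpow g m * g ^+ k)%g.
Proof.
elim: k => [|k IH]; first by rewrite addr0 mulg1.
have -> : m + k.+1%:Z = m + k%:Z + 1 by lia.
rewrite expgSr mulgA -IH; move: (m + k%:Z) => {IH} [n|n].
  by rewrite -PoszD addn1 /= expgSr.
case: n => [|n]; first by rewrite /= mulVg.
have -> : Negz n.+1 + 1 = Negz n by lia.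
by rewrite /= (expgS _ n.+1) invgM mulgVK.
Qed.

Section Acylindrical.
Variables (R : realType) (G : groupType) (d : tree_pseudometric R G).
Variable len : G -> G -> nat.
Hypothesis dE : forall x y, d x y = (len x y)%:R.

Lemma translation_loxodromic g :
  (forall n, len 1%g (g ^+ n)%g = n.*2) -> loxodromic (rtree_action d) g.
Proof.
move=> lenX; exists (rvertex d 1%g), 2, 0; split; [lra|lra|] => m n.
rewrite !rtree_act_vertex !mulg1 mdist_rvertex.
suff -> : d (zpow g m) (zpow g n) = 2 * `|m - n|%:~R.
  rewrite subr0 addr0 lexx andbT.
  have : (0 : R) <= `|m - n|%:~R by rewrite ler0z.
  set a := `|m - n|%:~R; lra.
wlog mn : m n / m <= n => [W|].
  have [/W //|/ltW/W nm] := leP m n.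
  by rewrite tdist_sym nm distrC.
have [k ->] : exists k : nat, n = m + k%:Z by exists `|n - m|%N; lia.
rewrite zpow_addn -[zpow g m in X in d X _]mulg1 tdist_mul dE lenX.
by rewrite opprD addrA subrr add0r normrN -muln2 natrM mulrC.
Qed.

(** The group elements moving the far apart points [p], [q] by at most [eps] move
    an intermediate vertex [v] along the segment through [p] and [q], and by at
    most [eps]. Only boundedly many positions are possible for the image, and
    the position determines the element up to the finite stabilizer of [v]. *)
Lemma rtree_acylindrical :
    (forall x y i, (i <= len x y)%N ->
       exists2 v, len x v = i & len v y = (len x y - i)%N) ->
    finite_set [set g | len 1%g g = 0%N] ->
  acylindrical (rtree_action d).
Proof.
move=> between finK eps eps0.
have [E epsE] : exists E : nat, eps <= E%:R.
  by exists (Num.bound eps); exact/ltW/archi_boundP/ltW.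
have [N NP] : exists N, ((`I_(E.*2.+1) `*` [set g | len 1%g g = 0%N]) #<= `I_N)%card.
  by apply/finite_set_leP; apply: finite_setX => //; exact: finite_II.
exists (2 * E%:R + 2), N; split=> [|p q pqM]; first by have := ler0n R E; lra.
set A := [set g | _]; apply: card_le_trans NP.
have [x [y [s [t [sP tP st pE qE]]]]] := rtree_pair p q.
have pqE : mdist p q = t - s.
  by rewrite mdist_rtree pE qE pdist_seg; [rewrite ler0_norm; lra|lra|lra].
rewrite pqE in pqM.
(* More than [eps] away from both [p] and [q]. *)
pose i := (Num.truncn s + E.+1)%N.
have s0 : 0 <= s by lra.
have iE : i%:R = (Num.truncn s)%:R + E%:R + 1 :> R by rewrite /i natrD -addn1 natrD addrA.
have /andP[is1 is2] := truncn_itv s0; rewrite -addn1 natrD in is2.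
have E0 := ler0n R E.
have ixy : (i <= len x y)%N.
  by rewrite -(ler_nat R) -dE; lra.
have [v xv vy] := between x y i ixy.
have vP : d x v + d v y = d x y by rewrite !dE xv vy -natrD subnKC.
have dxv : d x v = i%:R by rewrite dE xv.
have vE := rvertex_between vP; rewrite dxv in vE.
pose z := rvertex d v.
have pz : mdist p z = i%:R - s.
  by rewrite mdist_rtree pE vE pdist_seg; [rewrite ler0_norm; lra|lra|exact: ler0n].
have qz : mdist q z = t - i%:R.
  by rewrite mdist_rtree qE vE pdist_seg; [rewrite ger0_norm; lra|lra|exact: ler0n].
have xp : mdist (rvertex d x) p = s by apply: mdist_start pE.
have qy : mdist q (rvertex d y) = d x y - t by apply: mdist_end qE.
(* The points [p] and [q] move less than their distance to [v], so by the
   four-point condition the image of [v] stays on the segment between them. *)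
have gv g : A g -> d x (g * v)%g + d (g * v)%g y = d x y /\
    `|d x (g * v)%g - i%:R| <= eps.
  move=> [gp gq]; pose z' := rvertex d (g * v)%g.
  pose p' := rtree_action d g p; pose q' := rtree_action d g q.
  have z'E : rtree_action d g z = z' by exact: rtree_act_vertex.
  have p'z : mdist p' z' = i%:R - s by rewrite -z'E act_isom.
  have q'z : mdist q' z' = t - i%:R by rewrite -z'E act_isom.
  have p'q' : mdist p' q' = t - s by rewrite act_isom.
  have h1 := rtree_four p' p q z'.
  have h2 := rtree_four p' q q' z'.
  rewrite -/p' in gp; rewrite -/q' in gq.
  have pp' := metric_sym p p'.
  have t1 := metric_triangle p p' z'; have t2 := metric_triangle p' p z'.
  have t3 := metric_triangle q q' z'; have t4 := metric_triangle q' q z'.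
  have qq' := metric_sym q q'.
  have t5 := metric_triangle p z' q; rewrite (metric_sym z' q) in t5.
  have on : mdist p z' + mdist q z' = t - s.
    move: h1 h2; rewrite !maxEle; case: ifP => ?; case: ifP => ?; lra.
  have x1 := metric_triangle (rvertex d x) p z'.
  have y1 := metric_triangle z' q (rvertex d y).
  rewrite (metric_sym z' q) in y1; rewrite !mdist_rvertex in x1 y1.
  have := tdist_triangle d (g * v)%g x y.
  by split; [lra|rewrite ler_norml; lra].
pose c g := (len x (g * v)%g + E - i)%N.
have cP g : A g -> (c g < E.*2.+1)%N /\ (c g + i = len x (g * v)%g + E)%N.
  move=> /gv[_]; rewrite dE ler_norml => /andP[l1 l2].
  have {}l1 : (i <= len x (g * v)%g + E)%N by rewrite -(ler_nat R) natrD; lra.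
  have {}l2 : (len x (g * v)%g <= i + E)%N by rewrite -(ler_nat R) natrD; lra.
  by rewrite /c; split; lia.
have stab g h : A g -> A h -> c g = c h -> len 1%g ((g * v)^-1 * (h * v))%g = 0%N.
  move=> Ag Ah cgh; apply/eqP; rewrite -(eqr_nat R) -dE.
  rewrite -(tdist_mul d (g * v)%g) mulg1 mulVKg.
  have [gP _] := gv _ Ag; have [hP _] := gv _ Ah.
  have [_ cg] := cP _ Ag; have [_ ch] := cP _ Ah.
  have eqx : d x (g * v)%g = d x (h * v)%g by rewrite !dE; congr (_%:R); lia.
  have := tdist_four d (g * v)%g x (h * v)%g y.
  have := tdist_ge0 d (g * v)%g (h * v)%g.
  rewrite (tdist_sym d (g * v)%g x) => h0 h1; apply/eqP.
  by move: h1; rewrite maxEle; case: ifP => ?; lra.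
pose r j := xget 1%g [set g | A g /\ c g = j].
have rP g : A g -> A (r (c g)) /\ c (r (c g)) = c g.
  by move=> Ag; rewrite /r; case: xgetP => [h _ //|/(_ g)]; case.
pose f g := (c g, (r (c g) * v)^-1 * (g * v))%g.
have finj : {in A &, injective f}.
  move=> g h _ _ [cgh]; rewrite cgh.
  by move=> /mulgI/mulIg.
rewrite -(card_le_eql (inj_card_eq finj)); apply: subset_card_le => _ [g Ag <-].
have [Ar cr] := rP _ Ag.
by split; [exact: (cP _ Ag).1|exact: stab].
Qed.

End Acylindrical.

(** * The tree of an amalgamated product *)

Section AmalgamTree.
Variables (A B C : groupType).
Variables (f : {multiplicative C -> A}) (g : {multiplicative C -> B}).
Hypotheses (f_inj : injective f) (g_inj : injective g).

Local Open Scope group_scope.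
Local Notation fac := (amalgam_factor A B).
Local Notation letter := {b : bool & fac b}.
Local Notation rel := (amalgam_rel f g).
Implicit Types (b : bool) (c : C) (l m : seq letter).

Definition edge b : {multiplicative C -> fac b} :=
  match b return {multiplicative C -> fac b} with true => f | false => g end.

Lemma edge_inj b : injective (edge b). Proof. by case: b. Qed.

(** A representative of the left coset of [x], equal to [1] for the coset of [1]:
    a letter of a normal form is trivial exactly when it lies in [C]. *)
Definition coset_rep b (x : fac b) : fac b :=
  if `[< exists c, x = edge b c >] then 1
  else xget 1 [set y | exists c, x = y * edge b c]%classic.

Definition coset_part b (x : fac b) : C :=
  xget 1 [set c | x = coset_rep x * edge b c]%classic.

Lemma coset_decomp b (x : fac b) : x = coset_rep x * edge b (coset_part x).
Proof.
rewrite /coset_part; case: xgetP => // no.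
suff [c cP] : exists c, x = coset_rep x * edge b c by case: (no c).
rewrite /coset_rep; case: asboolP => [[c ->]|_]; first by exists c; rewrite mul1g.
case: xgetP => [y _ //|/(_ x)[]].
by exists 1; rewrite mult1 mulg1.
Qed.

Lemma coset_rep_mul b (x : fac b) c : coset_rep (x * edge b c) = coset_rep x.
Proof.
rewrite /coset_rep; have [[c' ->]|no] := asboolP (exists c', x = edge b c').
  by rewrite -gmulfM asboolT //; exists (c' * c).
rewrite asboolF; last first.
  move=> [c' xc]; apply: no; exists (c' * c^-1).
  by rewrite gmulfM multV -xc mulgK.
congr xget; apply/seteqP; split => y /= [c' yP].
  by exists (c' * c^-1); rewrite gmulfM multV mulgA -yP mulgK.
by exists (c' * c); rewrite gmulfM mulgA -yP.
Qed.

Lemma coset_part_mul b (x : fac b) c : coset_part (x * edge b c) = coset_part x * c.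
Proof.
apply: (@edge_inj b); apply: (mulgI (coset_rep x)).
by rewrite gmulfM mulgA -coset_decomp -{1}(coset_rep_mul x c) -coset_decomp.
Qed.

Lemma coset_repE b (x : fac b) : coset_rep x = x * edge b (coset_part x)^-1.
Proof. by rewrite {2}[x]coset_decomp multV mulgK. Qed.

Lemma coset_rep_id b (x : fac b) : coset_rep (coset_rep x) = coset_rep x.
Proof. by rewrite {1}[coset_rep x]coset_repE coset_rep_mul. Qed.

Lemma coset_rep_edge b c : coset_rep (edge b c) = 1.
Proof. by rewrite /coset_rep asboolT //; exists c. Qed.

Lemma coset_rep1 b : coset_rep (1 : fac b) = 1.
Proof. by rewrite -{1}(mult1 (edge b)) coset_rep_edge. Qed.

Lemma coset_part_edge b c : coset_part (edge b c) = c.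
Proof.
by apply: (@edge_inj b); rewrite {2}[edge b c]coset_decomp coset_rep_edge mul1g.
Qed.

Lemma coset_part_rep b (x : fac b) : coset_rep x = x -> coset_part x = 1.
Proof.
move=> xE; apply: (@edge_inj b); apply: (mulgI x).
by rewrite mult1 mulg1 -{1}xE -coset_decomp.
Qed.

Lemma coset_rep_mull b (x y : fac b) : coset_rep (x * y) = coset_rep (x * coset_rep y).
Proof. by rewrite {1}[y]coset_decomp mulgA coset_rep_mul. Qed.

Lemma coset_rep_mulI b (x y z : fac b) :
  (coset_rep (x * y) == coset_rep (x * z)) = (coset_rep y == coset_rep z).
Proof.
apply/eqP/eqP => [yz|yz]; last by rewrite coset_rep_mull yz -coset_rep_mull.
by rewrite -(mulKg x y) -(mulKg x z) coset_rep_mull yz -coset_rep_mull.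
Qed.

(** Normal forms [s_1 s_2 ... s_n] of the left cosets of the amalgamated
    subgroup: the [s_i] are nontrivial coset representatives, taken alternately
    in the two factors. *)
Definition starts_not b l := if l is u :: _ then tag u != b else true.

Fixpoint normal l : bool :=
  if l is u :: l' then
    [&& coset_rep (tagged u) == tagged u, tagged u != 1, starts_not (tag u) l' & normal l']
  else true.

(** Multiplying a normal form by [c] on the left changes the representatives one
    after another, and the last element of [C] that remains is absorbed in the
    coset. *)
Fixpoint edge_act c l : seq letter :=
  if l is u :: l' then
    let x := edge (tag u) c * tagged u in
    Tagged fac (coset_rep x) :: edge_act (coset_part x) l'
  else [::].

Lemma size_edge_act c l : size (edge_act c l) = size l.
Proof. by elim: l c => //= u l IH c; rewrite IH. Qed.

Lemma starts_not_edge_act b c l : starts_not b (edge_act c l) = starts_not b l.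
Proof. by case: l. Qed.

Lemma normal_edge_act c l : normal l -> normal (edge_act c l).
Proof.
elim: l c => //= -[b s] l IH c /= /and4P[/eqP sr s1 bl nl].
rewrite coset_rep_id eqxx starts_not_edge_act bl IH //= andbT.
apply: contraNneq s1 => rep1; rewrite -sr -(coset_rep1 b).
by rewrite -(coset_rep_mulI (edge b c)) rep1 mulg1 coset_rep_edge.
Qed.

Lemma edge_act1 l : normal l -> edge_act 1 l = l.
Proof.
elim: l => //= -[b s] l IH /= /and4P[/eqP sr _ _ nl].
by rewrite mult1 mul1g sr coset_part_rep // IH.
Qed.

Lemma edge_actM c c' l : edge_act (c * c') l = edge_act c (edge_act c' l).
Proof.
elim: l c c' => //= -[b s] l IH c c' /=.
set x := edge b c' * s.
have -> : edge b (c * c') * s = edge b c * coset_rep x * edge b (coset_part x).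
  by rewrite gmulfM -!mulgA -coset_decomp.
by rewrite coset_rep_mul coset_part_mul IH.
Qed.

(** The first letter if it belongs to the factor [b], and [1] otherwise: the
    function [tagged_as] falls back on its first argument. *)
Definition head b l : fac b :=
  if l is u :: _ then tagged_as (Tagged fac (1 : fac b)) u else 1.

Definition tail b l : seq letter :=
  if l is u :: l' then (if tag u == b then l' else l) else [::].

Definition push b (x : fac b) l : seq letter :=
  if coset_rep x == 1 then edge_act (coset_part x) l
  else Tagged fac (coset_rep x) :: edge_act (coset_part x) l.

(** Left multiplication by an element of a factor, on normal forms. *)
Definition left_act b (x : fac b) l : seq letter := push (x * head b l) (tail b l).

Lemma head_cons b (s : fac b) l : head b (Tagged fac s :: l) = s.
Proof. exact: (tagged_asE (u := Tagged fac (1 : fac b)) s). Qed.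

Lemma tail_cons b (s : fac b) l : tail b (Tagged fac s :: l) = l.
Proof. by rewrite /= eqxx. Qed.

Lemma head_starts_not b l : starts_not b l -> head b l = 1.
Proof.
case: l => //= u _ ub; rewrite /tagged_as; case: eqP => //= e.
by rewrite -e eqxx in ub.
Qed.

Lemma tail_starts_not b l : starts_not b l -> tail b l = l.
Proof. by case: l => //= u l /negPf ->. Qed.

Lemma startsP b l :
  (exists (s : fac b) m, l = Tagged fac s :: m) \/ starts_not b l.
Proof.
case: l => [|[b' s] l] /=; first by right.
by have [e|] := eqVneq b' b; [left; subst b'; exists s, l|right].
Qed.

Lemma normal_tail b l : normal l -> normal (tail b l) /\ starts_not b (tail b l).
Proof.
case: (startsP b l) => [[s [m ->]]|sl nl]; last by rewrite tail_starts_not.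
by rewrite tail_cons /= => /and4P[].
Qed.

Lemma push_rep b (s : fac b) l :
  coset_rep s = s -> s != 1 -> normal l -> push s l = Tagged fac s :: l.
Proof. by move=> sr s1 nl; rewrite /push sr (negPf s1) coset_part_rep // edge_act1. Qed.

Lemma push_head_tail b l : normal l -> push (head b l) (tail b l) = l.
Proof.
case: (startsP b l) => [[s [m ->]]|sl nl].
  by rewrite head_cons tail_cons /= => /and4P[/eqP sr s1 _]; exact: push_rep.
rewrite head_starts_not ?tail_starts_not // /push coset_rep1 eqxx.
by rewrite coset_part_rep ?coset_rep1 // edge_act1.
Qed.

Lemma head_push b (x : fac b) l : starts_not b l -> head b (push x l) = coset_rep x.
Proof.
move=> bl; rewrite /push; case: eqP => [->|_]; last exact: head_cons.
by rewrite head_starts_not // starts_not_edge_act.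
Qed.

Lemma tail_push b (x : fac b) l :
  starts_not b l -> tail b (push x l) = edge_act (coset_part x) l.
Proof.
move=> bl; rewrite /push; case: eqP => [_|_]; last exact: tail_cons.
by rewrite tail_starts_not // starts_not_edge_act.
Qed.

Lemma normal_push b (x : fac b) l : normal l -> starts_not b l -> normal (push x l).
Proof.
move=> nl bl; rewrite /push; case: eqP => [_|/eqP x1]; first exact: normal_edge_act.
by rewrite /= coset_rep_id eqxx x1 starts_not_edge_act bl normal_edge_act.
Qed.

Lemma push_edge b (x : fac b) c l : push (x * edge b c) l = push x (edge_act c l).
Proof. by rewrite /push coset_rep_mul coset_part_mul edge_actM. Qed.

Lemma normal_left_act b (x : fac b) l : normal l -> normal (left_act x l).
Proof. by move=> /(normal_tail b)[nt bt]; exact: normal_push. Qed.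

Lemma left_act1 b l : normal l -> left_act (1 : fac b) l = l.
Proof. by move=> nl; rewrite /left_act mul1g push_head_tail. Qed.

Lemma left_actM b (x y : fac b) l :
  normal l -> left_act (x * y) l = left_act x (left_act y l).
Proof.
move=> /(normal_tail b)[nt bt]; rewrite /left_act head_push // tail_push //.
by rewrite -push_edge -[RHS]/(push _ _) -(mulgA x (coset_rep _)) -coset_decomp mulgA.
Qed.

Lemma left_act_edge b c l : normal l -> left_act (edge b c) l = edge_act c l.
Proof.
rewrite /left_act; case: (startsP b l) => [[s [m ->]]|bl nl]; last first.
  rewrite head_starts_not ?tail_starts_not // mulg1 /push.
  by rewrite coset_rep_edge eqxx coset_part_edge.
move=> /(normal_edge_act c); rewrite head_cons tail_cons /push /=.
by case/and4P => _ /negPf -> _ _.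
Qed.

(** Factors agree on [C] by [left_act_edge], so the left multiplications
    assemble to an action of the amalgam. *)
Definition word_act (s : seq letter) l : seq letter :=
  foldr (fun u => left_act (tagged u)) l s.

Lemma normal_word_act s l : normal l -> normal (word_act s l).
Proof. by move=> nl; elim: s => //= u s; exact: normal_left_act. Qed.

Lemma word_act_cat s t l : word_act (s ++ t) l = word_act s (word_act t l).
Proof. exact: foldr_cat. Qed.

Lemma word_act_eqv s t l : colim_eqv rel s t -> normal l -> word_act s l = word_act t l.
Proof.
move=> st; elim: st l => {s t}.
- by [].
- by move=> s t _ IH l nl; rewrite IH.
- by move=> s t u _ IHs _ IHt l nl; rewrite IHs ?IHt.
- move=> s s' t t' _ IHs _ IHt l nl.
  by rewrite !word_act_cat (IHt _ nl) IHs // normal_word_act.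
- by move=> b l nl; exact: left_act1.
- by move=> b x y l nl; rewrite /= left_actM.
- move=> _ _ [c] l nl /=.
  by rewrite (left_act_edge true) // (left_act_edge false).
Qed.

Definition amalgam_act (x : amalgam f g) l : seq letter := word_act (repr x) l.

Lemma amalgam_act_class s l : normal l -> amalgam_act (colim_class rel s) l = word_act s l.
Proof. by apply: word_act_eqv; exact: colim_repr. Qed.

Lemma amalgam_act1 l : normal l -> amalgam_act 1 l = l.
Proof. exact: (@amalgam_act_class [::]). Qed.

Lemma amalgam_actM x y l :
  normal l -> amalgam_act (x * y) l = amalgam_act x (amalgam_act y l).
Proof. by move=> nl; rewrite [LHS]amalgam_act_class // word_act_cat. Qed.

Lemma normal_amalgam_act x l : normal l -> normal (amalgam_act x l).
Proof. exact: normal_word_act. Qed.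

(** A normal form is a path of edges in the tree; twice the length of the common
    part of two paths is computed by [branch], where two paths that diverge in
    the same factor share half an edge more. *)
Fixpoint branch l m : nat :=
  match l, m with
  | u :: l', v :: m' => if u == v then (branch l' m').+2 else nat_of_bool (tag u == tag v)
  | _, _ => 0%N
  end.

Lemma branchC l m : branch l m = branch m l.
Proof. by elim: l m => [|u l IH] [|v m] //=; rewrite IH eq_sym (eq_sym (tag u)). Qed.

Lemma branch_leq l m : (branch l m <= size l + size m)%N.
Proof.
elim: l m => [|u l IH] [|v m] //=; case: ifP => _; last by case: eqP; lia.
by have := IH m; lia.
Qed.

Lemma branch_take i l : (i <= size l)%N -> branch (take i l) l = i.*2.
Proof. by elim: l i => [|u l IH] [|i] //= il; rewrite eqxx IH. Qed.

Lemma branch_ultra l m n : (minn (branch l m) (branch m n) <= branch l n)%N.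
Proof.
elim: l m n => [|u l IH] [|v m] [|w n] //=; rewrite ?minn0 ?min0n //.
have [uv|uv] := eqVneq u v.
  have [vw|vw] := eqVneq v w; last by rewrite uv (negPf vw) geq_minr.
  by rewrite uv vw eqxx; have := IH m n; lia.
have [vw|vw] := eqVneq v w; first by rewrite -vw (negPf uv) geq_minl.
have [uw|uw] := eqVneq u w; first by apply: leq_trans (geq_minl _ _) _; case: eqP.
by case: eqP => [->|_]; [case: eqP|rewrite min0n].
Qed.

(** The distance between the midpoints of the last edges of two paths. *)
Definition path_dist l m : nat := (size l + size m - branch l m)%N.

Lemma path_dist_refl l : path_dist l l = 0%N.
Proof. by rewrite /path_dist -{3}[l]take_size branch_take // addnn subnn. Qed.

Lemma path_distC l m : path_dist l m = path_dist m l.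
Proof. by rewrite /path_dist addnC branchC. Qed.

Lemma path_dist_nil l : path_dist [::] l = size l.
Proof. by rewrite /path_dist subn0. Qed.

(** The common prefixes of paths in a rooted tree form an ultrametric, and this
    gives the four-point condition for the tree metric. *)
Lemma path_dist_four l1 l2 l3 l4 : (path_dist l1 l3 + path_dist l2 l4
  <= maxn (path_dist l1 l2 + path_dist l3 l4) (path_dist l2 l3 + path_dist l1 l4))%N.
Proof.
have key : (minn (branch l1 l2 + branch l3 l4) (branch l2 l3 + branch l1 l4)
    <= branch l1 l3 + branch l2 l4)%N.
  have := branch_ultra l1 l2 l3; have := branch_ultra l1 l4 l3.
  have := branch_ultra l2 l1 l4; have := branch_ultra l2 l3 l4.
  have := branch_ultra l1 l3 l2; have := branch_ultra l1 l3 l4.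
  have := branch_ultra l2 l4 l1; have := branch_ultra l2 l4 l3.
  rewrite (branchC l4 l3) (branchC l2 l1) (branchC l3 l2) (branchC l4 l1).
  lia.
have := branch_leq l1 l2; have := branch_leq l1 l3; have := branch_leq l1 l4.
have := branch_leq l2 l3; have := branch_leq l2 l4; have := branch_leq l3 l4.
rewrite /path_dist; lia.
Qed.

Lemma branch_edge_act c l m :
  normal l -> normal m -> branch (edge_act c l) (edge_act c m) = branch l m.
Proof.
elim: l m c => [|[b s] l IH] [|[b' t] m] c //= /and4P[/eqP sr _ _ nl] /and4P[/eqP tr _ _ nm].
have [e|bb'] := eqVneq b b'; last first.
  have neq (x : fac b) (y : fac b') : Tagged fac x != Tagged fac y.
    by apply: contraNneq bb' => /(congr1 tag) /= ->.
  by rewrite !(negPf (neq _ _)).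
subst b'; rewrite !eq_Tagged /= coset_rep_mulI sr tr.
by case: eqP => // <-; rewrite IH.
Qed.

Lemma path_dist_edge_act c l m : normal l -> normal m ->
  path_dist (edge_act c l) (edge_act c m) = path_dist l m.
Proof. by move=> nl nm; rewrite /path_dist !size_edge_act branch_edge_act. Qed.

Lemma path_dist_push b (x y : fac b) l m :
    starts_not b l -> starts_not b m ->
  path_dist (push x l) (push y m) =
    if coset_rep x == coset_rep y
    then path_dist (edge_act (coset_part x) l) (edge_act (coset_part y) m)
    else (size l + size m).+1.
Proof.
have nohead (s : fac b) l' m' : starts_not b m' -> branch (Tagged fac s :: l') m' = 0%N.
  case: m' => //= v m' vb; case: eqP => [e|_].
    by rewrite -e /= eqxx in vb.
  by rewrite eq_sym (negPf vb).
rewrite -(starts_not_edge_act b (coset_part x) l) => bl.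
rewrite -(starts_not_edge_act b (coset_part y) m) => bm.
rewrite -(size_edge_act (coset_part x) l) -(size_edge_act (coset_part y) m).
rewrite /push; move: (edge_act _ l) (edge_act _ m) bl bm => {}l {}m bl bm.
case: eqP => [->|x1]; case: eqP => [->|y1]; rewrite ?eqxx //.
- rewrite eq_sym (_ : (_ == _) = false); last exact/eqP.
  by rewrite /path_dist branchC nohead //=; lia.
- rewrite (_ : (_ == _) = false); last exact/eqP.
  by rewrite /path_dist nohead //=; lia.
- rewrite /path_dist /= eq_Tagged /=; case: ifP => _; rewrite ?eqxx; lia.
Qed.

(** Left multiplication changes the first letter and then acts by [C] on what
    follows; two paths keep a common first letter, or keep different ones. *)
Lemma path_dist_left_act b (x : fac b) l m : normal l -> normal m ->
  path_dist (left_act x l) (left_act x m) = path_dist l m.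
Proof.
move=> nl nm; rewrite -[in RHS](push_head_tail b nl) -[in RHS](push_head_tail b nm).
have [nlt blt] := normal_tail b nl; have [nmt bmt] := normal_tail b nm.
rewrite /left_act; move: (head b l) (head b m) (tail b l) (tail b m) nlt blt nmt bmt.
move=> {nl nm} {}y z {}l {}m nl bl nm bm.
rewrite !path_dist_push // coset_rep_mulI; case: eqP => // yz.
have part (w : fac b) : coset_part (x * w) = coset_part (x * coset_rep w) * coset_part w.
  by rewrite -coset_part_mul -mulgA -coset_decomp.
rewrite (part y) (part z) yz !edge_actM path_dist_edge_act //; exact: normal_edge_act.
Qed.

Lemma path_dist_act x l m : normal l -> normal m ->
  path_dist (amalgam_act x l) (amalgam_act x m) = path_dist l m.
Proof.
move=> nl nm; rewrite /amalgam_act; elim: (repr x) => //= u s IH.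
by rewrite path_dist_left_act //; exact: normal_word_act.
Qed.

Definition amalgam_len (x y : amalgam f g) : nat :=
  path_dist (amalgam_act x [::]) (amalgam_act y [::]).

Lemma amalgam_len_mul z x y : amalgam_len (z * x) (z * y) = amalgam_len x y.
Proof.
by rewrite /amalgam_len !amalgam_actM // path_dist_act //; exact: normal_amalgam_act.
Qed.

Lemma amalgam_len1 x : amalgam_len 1 x = size (amalgam_act x [::]).
Proof. by rewrite /amalgam_len amalgam_act1 // path_dist_nil. Qed.

Lemma amalgam_act_normal l : normal l -> amalgam_act (colim_class rel l) [::] = l.
Proof.
rewrite amalgam_act_class //; elim: l => //= -[b s] l IH /= /and4P[/eqP sr s1 bl nl].
rewrite IH // /left_act head_starts_not // tail_starts_not // mulg1.
exact: push_rep.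
Qed.

Lemma normal_take i l : normal l -> normal (take i l).
Proof.
elim: l i => [|u l IH] [|i] //= /and4P[-> -> bl nl].
by rewrite IH // andbT; case: l bl {IH nl} => [|v l]; case: i.
Qed.

Lemma amalgam_len_between x y i : (i <= amalgam_len x y)%N ->
  exists2 v, amalgam_len x v = i & amalgam_len v y = (amalgam_len x y - i)%N.
Proof.
have -> : amalgam_len x y = amalgam_len 1 (x^-1 * y).
  by rewrite -[RHS](amalgam_len_mul x) mulg1 mulVKg.
set z := x^-1 * y; rewrite amalgam_len1; set l := amalgam_act z [::] => il.
have nl : normal l by exact: normal_amalgam_act.
exists (x * colim_class rel (take i l)).
  rewrite -[x in amalgam_len x _]mulg1 amalgam_len_mul amalgam_len1.
  by rewrite amalgam_act_normal ?normal_take // size_takel.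
rewrite -[y](mulVKg x) amalgam_len_mul /amalgam_len.
rewrite amalgam_act_normal ?normal_take // -/z -/l /path_dist.
by rewrite branch_take // size_takel //; lia.
Qed.

Let edge_in c : amalgam f g := amalgam_l f g (f c).

Lemma edge_inE b c : edge_in c = colim_in rel (edge b c).
Proof. by case: b => //; exact: amalgam_glue. Qed.

Lemma colim_class_cons u s : colim_class rel (u :: s) = colim_in rel (tagged u) * colim_class rel s.
Proof. by rewrite [RHS]colim_mulE; case: u. Qed.

(** Up to a factor in [C] on the right, the action on normal forms is left
    multiplication in the amalgam. *)
Lemma class_edge_act c l : exists c',
  edge_in c * colim_class rel l = colim_class rel (edge_act c l) * edge_in c'.
Proof.
elim: l c => [|[b s] l IH] c; first by exists c; exact: etrans (mulg1 _) (esym (mul1g _)).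
rewrite /= !colim_class_cons /= (edge_inE b) mulgA -colim_inM.
set x := edge b c * s; rewrite {1}(coset_decomp x) colim_inM -(edge_inE b).
have [c' c'P] := IH (coset_part x); exists c'.
by rewrite -!mulgA c'P.
Qed.

Lemma class_push b (x : fac b) l : exists c,
  colim_in rel x * colim_class rel l = colim_class rel (push x l) * edge_in c.
Proof.
have [c cP] := class_edge_act (coset_part x) l; exists c.
rewrite {1}(coset_decomp x) colim_inM -(edge_inE b) -mulgA cP /push.
case: eqP => [->|_]; first by rewrite mult1 mul1g.
by rewrite colim_class_cons mulgA.
Qed.

Lemma class_left_act b (x : fac b) l : exists c,
  colim_in rel x * colim_class rel l = colim_class rel (left_act x l) * edge_in c.
Proof.
rewrite /left_act; have [c cP] := class_push (x * head b l) (tail b l); exists c.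
rewrite -cP colim_inM -mulgA; congr (_ * _).
case: (startsP b l) => [[s [m ->]]|bl].
  by rewrite head_cons tail_cons colim_class_cons.
by rewrite head_starts_not // tail_starts_not // mult1 mul1g.
Qed.

Lemma class_amalgam_act x : exists c,
  x = colim_class rel (amalgam_act x [::]) * edge_in c.
Proof.
rewrite -{1}(colim_reprK x) /amalgam_act; elim: (repr x) => [|u s [c IH]].
  by exists 1; rewrite /edge_in !mult1 mulg1.
have [c' c'P] := class_left_act (tagged u) (word_act s [::]).
exists (c' * c); rewrite colim_class_cons IH mulgA c'P /edge_in !gmulfM.
by rewrite mulgA.
Qed.

(** The elements at distance [0] from [1] are those fixing the base edge, whose
    stabilizer is [C]. *)
Lemma amalgam_len_eq0 x : amalgam_len 1 x = 0%N -> exists c, x = amalgam_l f g (f c).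
Proof.
rewrite amalgam_len1 => /size0nil x0; have [c] := class_amalgam_act x.
by rewrite x0 => xE; exists c; rewrite xE; exact: mul1g.
Qed.

Lemma size_left_act b (x : fac b) l :
    (forall c, x <> edge b c) -> starts_not b l ->
  size (left_act x l) = (size l).+1 /\ starts_not (~~ b) (left_act x l).
Proof.
move=> xC bl; rewrite /left_act head_starts_not // tail_starts_not // mulg1 /push.
case: eqP => [x1|_] /=; last by rewrite size_edge_act; case: b {x xC bl}.
by case: (xC (coset_part x)); rewrite {1}[x]coset_decomp x1 mul1g.
Qed.

(** If the normal form of [w] does not start in the factor of [y], then that of
    [x * y * w] is two letters longer and again does not. *)
Lemma amalgam_len_power (x : A) (y : B) n :
    (forall c, x <> f c) -> (forall c, y <> g c) ->
  amalgam_len 1 ((amalgam_l f g x * amalgam_r f g y) ^+ n) = n.*2.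
Proof.
move=> xC yC; rewrite amalgam_len1.
suff [] : size (amalgam_act ((amalgam_l f g x * amalgam_r f g y) ^+ n) [::]) = n.*2 /\
  starts_not false (amalgam_act ((amalgam_l f g x * amalgam_r f g y) ^+ n) [::]) by [].
elim: n => [|n [IHn IHs]]; first by rewrite amalgam_act1.
rewrite expgS -mulgA !amalgam_actM //.
set l := amalgam_act _ [::] in IHn IHs *.
have nl : normal l by exact: normal_amalgam_act.
rewrite (amalgam_act_class [:: Tagged fac (y : fac false)]) //.
have [sy ly] := @size_left_act false y l yC IHs.
rewrite (amalgam_act_class [:: Tagged fac (x : fac true)]); last exact: normal_left_act.
have [sx bx] := @size_left_act true x (left_act (y : fac false) l) xC ly.
by rewrite /= sx sy IHn.
Qed.

Variable R : realType.

Definition amalgam_tree : tree_pseudometric R (amalgam f g).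
Proof.
apply: (@TreePseudometric R _ (fun x y => (amalgam_len x y)%:R)%R).
- by move=> x; rewrite /amalgam_len path_dist_refl.
- by move=> x y; rewrite /amalgam_len path_distC.
- move=> x y z w; rewrite -!natrD -natr_max ler_nat; exact: path_dist_four.
- by move=> z x y; rewrite amalgam_len_mul.
Defined.

(** The action on the tree of the amalgam is acylindrical because edge
    stabilizers are conjugates of the finite group [C]. *)
Theorem amalgam_generalized_loxodromic (x : A) (y : B) :
    finite_set [set: C] -> (forall c, x <> f c) -> (forall c, y <> g c) ->
  generalized_loxodromic R (amalgam_l f g x * amalgam_r f g y).
Proof.
move=> finC xC yC; exists (rtree amalgam_tree : metricType R), (rtree_action amalgam_tree).
split; first exact: rtree_hyperbolic.
  apply: (rtree_acylindrical (len := amalgam_len)) => //.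
    exact: amalgam_len_between.
  apply: sub_finite_set (finite_image (fun c => amalgam_l f g (f c)) finC).
  by move=> z /= /amalgam_len_eq0[c ->]; exists c.
by apply: (translation_loxodromic (len := amalgam_len)) => // n; exact: amalgam_len_power.
Qed.

End AmalgamTree.

(** * Universal properties *)

Local Open Scope group_scope.

Lemma colim_lift (I : choiceType) (F : I -> groupType)
    (E : {i : I & F i} -> {i : I & F i} -> Prop) (T : groupType) (u : forall i, F i -> T) :
    (forall i, {morph u i : x y / x * y}) ->
    (forall x y, E x y -> u _ (tagged x) = u _ (tagged y)) ->
  exists h : {multiplicative colim E -> T}, forall i (x : F i), h (colim_in E x) = u i x.
Proof.
move=> uM uE.
have u1 i : u i 1 = 1 by apply: (mulgI (u i 1)); rewrite -uM !mulg1.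
pose ev (s : seq {i : I & F i}) : T := foldr (fun x t => u _ (tagged x) * t) 1 s.
have ev_cat s t : ev (s ++ t) = ev s * ev t.
  by elim: s => [|x s IH] /=; rewrite ?mul1g // IH mulgA.
have ev_eqv s t : colim_eqv E s t -> ev s = ev t.
  elim=> {s t} //=; first by move=> s t u' _ -> _ ->.
  - by move=> s s' t t' _ IHs _ IHt; rewrite !ev_cat IHs IHt.
  - by move=> i; rewrite u1 mulg1.
  - by move=> i x y; rewrite uM !mulg1.
  - by move=> x y /uE ->.
pose h (x : colim E) := ev (repr x).
have hE s : h (colim_class E s) = ev s by apply: ev_eqv; exact: colim_repr.
have hM : {morph h : x y / x * y}.
  by move=> x y; rewrite /h -ev_cat -[RHS]hE.
pose hh : {multiplicative colim E -> T} := HB.pack h (isMultiplicative.Build _ _ h hM).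
by exists hh => i x; rewrite -[LHS]/(h _) hE /= mulg1.
Qed.

Lemma colim_hom_ext (I : choiceType) (F : I -> groupType)
    (E : {i : I & F i} -> {i : I & F i} -> Prop) (T : groupType)
    (h k : {multiplicative colim E -> T}) :
  (forall i (x : F i), h (colim_in E x) = k (colim_in E x)) -> h =1 k.
Proof.
move=> hk x; rewrite -(colim_reprK x); elim: (repr x) => [|[i y] s IH].
  by rewrite -[colim_class E _]/(1 : colim E) !mult1.
have -> : colim_class E (Tagged F y :: s) = colim_in E y * colim_class E s.
  by rewrite [RHS]colim_mulE.
by rewrite !gmulfM IH hk.
Qed.

Lemma amalgam_lift (A B C T : groupType) (f : {multiplicative C -> A})
    (g : {multiplicative C -> B}) (u : A -> T) (v : B -> T) :
    {morph u : x y / x * y} -> {morph v : x y / x * y} ->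
    (forall c, u (f c) = v (g c)) ->
  exists h : {multiplicative amalgam f g -> T},
    (forall x, h (amalgam_l f g x) = u x) /\ (forall y, h (amalgam_r f g y) = v y).
Proof.
move=> uM vM uv.
pose w b : amalgam_factor A B b -> T :=
  if b return amalgam_factor A B b -> T then u else v.
have wM b : {morph w b : x y / x * y} by case: b.
have [h hP] := @colim_lift _ _ (amalgam_rel f g) T w wM (ltac:(by move=> _ _ [c] /=)).
by exists h; split=> x; [rewrite (hP true)|rewrite (hP false)].
Qed.

Lemma amalgam_hom_ext (A B C T : groupType) (f : {multiplicative C -> A})
    (g : {multiplicative C -> B}) (h k : {multiplicative amalgam f g -> T}) :
    (forall x, h (amalgam_l f g x) = k (amalgam_l f g x)) ->
    (forall y, h (amalgam_r f g y) = k (amalgam_r f g y)) ->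
  h =1 k.
Proof. by move=> hkl hkr; apply: colim_hom_ext => -[]. Qed.

Section InfAmalgamLift.
Variables G K : nat -> groupType.
Variables (f : forall k, {multiplicative K k -> G k})
          (g : forall k, {multiplicative K k -> G k.+1}).

(** The homomorphisms from the finite stages are chosen one after another, each
    extending the previous one, so that they pass to the direct limit. *)
Lemma inf_amalgam_lift (T : groupType) (u : forall k, G k -> T) :
    (forall k, {morph u k : x y / x * y}) ->
    (forall k c, u k (f k c) = u k.+1 (g k c)) ->
  exists h : {multiplicative inf_amalgam f g -> T},
    forall k x, h (inf_amalgam_in f g k x) = u k x.
Proof.
move=> uM uE.
pose D k := {h : {multiplicative iter_amalgam f g k -> T} |
  forall x, h (under_in (iter_amalgam f g k) x) = u k x}.
have next k (t : D k) :
    {t' : D k.+1 | forall x, sval t' (iter_amalgam_step f g k x) = sval t x}.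
  case: t => h hP; apply: cid.
  have [|h' [h'l h'r]] := @amalgam_lift _ _ _ T
      (under_in (iter_amalgam f g k) \o f k) (g k) h (u k.+1) (@gmulfM _ _ h) (uM k.+1).
    by move=> c /=; rewrite hP uE.
  by exists (exist _ h' h'r).
pose h0 : {multiplicative G 0%N -> T} :=
  HB.pack (u 0%N) (isMultiplicative.Build _ _ (u 0%N) (uM 0%N)).
have D0 : D 0%N by exists h0.
pose t : forall k, D k := nat_rect D D0 (fun k tk => sval (next k tk)).
have tP k x : sval (t k.+1) (iter_amalgam_step f g k x) = sval (t k) x.
  exact: (svalP (next k (t k))).
have [|x y [k z]|h hP] := @colim_lift _ _ (dirlim_rel (iter_amalgam_step f g)) T
    (fun k => sval (t k)).
- by move=> k; exact: gmulfM.
- by rewrite /= tP.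
by exists h => k x; rewrite [LHS]hP; exact: (svalP (t k)).
Qed.

Lemma inf_amalgam_hom_ext (T : groupType) (h k : {multiplicative inf_amalgam f g -> T}) :
  (forall i x, h (inf_amalgam_in f g i x) = k (inf_amalgam_in f g i x)) -> h =1 k.
Proof.
move=> hk; apply: colim_hom_ext => i.
elim: i => [|i IH] x; first exact: hk.
pose c := dirlim_in (iter_amalgam_step f g) i.+1.
suff : (h \o c : {multiplicative _ -> _}) =1 (k \o c : {multiplicative _ -> _}).
  by move=> /(_ x).
apply: amalgam_hom_ext => y; last exact: hk.
rewrite /= -[amalgam_l _ _ y]/(iter_amalgam_step f g i y) /c -dirlim_glue.
exact: IH.
Qed.

End InfAmalgamLift.

(** * Dunwoody's group as a colimit *)

(** Compatible homomorphisms on all the [G_i], [i > 0], and on [H]. All the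
    groups [G_i] live inside [gpVH], and working with functions on [gpVH] avoids
    comparing the types of [G_i] for different expressions of the index. *)
Record cone (T : groupType) (u : nat -> gpVH -> T) (v : gpH -> T) : Prop := Cone {
  coneM : forall i x y, (0 < i)%N -> x \in in_gpG i -> y \in in_gpG i ->
    u i (x * y) = u i x * u i y;
  coneK : forall i x, (0 < i)%N -> x \in in_gpK i -> u i x = u i.+1 x;
  cone_HM : {morph v : x y / x * y};
  cone_H : forall i h, (0 < i)%N -> h \in gpH_on i -> u i (1, h) = v h }.

(** Outside [G_i] the value is [1]; only elements of [G_i] matter below. *)
Definition to_gpG (i : nat) (x : gpVH) : gpG i := insubd (1 : gpG i) x.

Lemma to_gpGK i x : x \in in_gpG i -> val (to_gpG i x) = x.
Proof. exact: insubdK. Qed.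

Lemma to_gpG_val i (x : gpG i) : to_gpG i (val x) = x.
Proof. exact: valKd. Qed.

Lemma to_gpGM i x y : x \in in_gpG i -> y \in in_gpG i ->
  to_gpG i (x * y) = to_gpG i x * to_gpG i y.
Proof.
move=> xi yi; apply: val_inj; rewrite to_gpGK ?gpredM //.
by rewrite -[RHS]/(val (to_gpG i x) * val (to_gpG i y)) !to_gpGK.
Qed.

Lemma to_gpG_K i (c : gpK i) : gpK_G i c = to_gpG i (val c).
Proof. exact: (esym (to_gpG_val (gpK_G i c))). Qed.

Lemma to_gpG_KS i (c : gpK i) : gpK_GS i c = to_gpG i.+1 (val c).
Proof. exact: (esym (to_gpG_val (gpK_GS i c))). Qed.

(** The map from [G_i] to [gpP m], for [0 < i <= m.+1]. *)
Fixpoint P_in (m i : nat) : gpVH -> gpP m :=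
  match m return gpVH -> gpP m with
  | 0%N => fun x => gpP_in 0 (to_gpG 1 x)
  | m'.+1 => fun x => if i == m'.+2 then gpP_in m'.+1 (to_gpG m'.+2 x)
                      else amalgam_l (gpK_P m') (gpK_GS m'.+1) (P_in m' i x)
  end.

Lemma P_in_last m x : P_in m m.+1 x = gpP_in m (to_gpG m.+1 x).
Proof. by case: m => //= m; rewrite eqxx. Qed.

Lemma P_inM m i x y : (0 < i <= m.+1)%N -> x \in in_gpG i -> y \in in_gpG i ->
  P_in m i (x * y) = P_in m i x * P_in m i y.
Proof.
elim: m => [|m IH] im xi yi /=.
  have i1 : i = 1%N by lia.
  by subst i; rewrite to_gpGM // gmulfM.
case: eqP => [e|ne]; last by rewrite IH ?gmulfM //; lia.
by subst i; rewrite to_gpGM // gmulfM.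
Qed.

Lemma P_inK m i x : (0 < i <= m)%N -> x \in in_gpK i -> P_in m i x = P_in m i.+1 x.
Proof.
elim: m => [|m IH] im xi; first by lia.
have ne : (i == m.+2) = false by lia.
rewrite /= ne eqSS; case: (eqVneq i m.+1) => [e|ne']; last by rewrite IH //; lia.
subst i; rewrite P_in_last.
pose c : gpK m.+1 := exist _ x xi.
rewrite -[x in LHS]/(val c) -[x in RHS]/(val c) -to_gpG_K -to_gpG_KS.
exact: (amalgam_glue (gpK_P m) (gpK_GS m.+1)).
Qed.

Lemma P_lift (T : groupType) u v m : @cone T u v ->
  exists h : {multiplicative gpP m -> T},
    forall i x, (0 < i <= m.+1)%N -> x \in in_gpG i -> h (P_in m i x) = u i x.
Proof.
move=> uv.
have uM k : {morph (fun x : gpG k.+1 => u k.+1 (val x)) : x y / x * y}.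
  by move=> x y /=; rewrite (coneM uv) ?(valP x) ?(valP y).
elim: m => [|m [h hP]].
  pose h : {multiplicative gpP 0 -> T} := HB.pack (fun x : gpG 1 => u 1%N (val x))
    (isMultiplicative.Build _ _ (fun x : gpG 1 => u 1%N (val x)) (uM 0%N)).
  exists h => i x i1; have -> : i = 1%N by lia.
  by move=> xi; rewrite /= -[LHS]/(u 1%N (val (to_gpG 1 x))) to_gpGK.
have [|h' [h'l h'r]] := @amalgam_lift _ _ _ T (gpK_P m) (gpK_GS m.+1) h
    (fun x : gpG m.+2 => u m.+2 (val x)) (@gmulfM _ _ h) (uM m.+1).
  move=> c; rewrite /gpK_P /= to_gpG_K -P_in_last hP ?leqnn //; last first.
    exact/in_gpK_G/(valP c).
  by rewrite (coneK uv) //; exact: (valP c).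
exists h' => i x im xi /=; case: eqP => [e|ne].
  by subst i; rewrite [LHS]h'r to_gpGK.
by rewrite h'l hP //; lia.
Qed.

Lemma P_hom_ext (T : groupType) m (h k : {multiplicative gpP m -> T}) :
    (forall i x, (0 < i <= m.+1)%N -> x \in in_gpG i -> h (P_in m i x) = k (P_in m i x)) ->
  h =1 k.
Proof.
elim: m h k => [|m IH] h k hk.
  move=> x; have := hk 1%N (val x) isT (valP x).
  by rewrite /= to_gpG_val.
apply: amalgam_hom_ext => [x|y].
  pose c := amalgam_l (gpK_P m) (gpK_GS m.+1).
  suff : (h \o c : {multiplicative _ -> _}) =1 (k \o c : {multiplicative _ -> _}).
    by move=> /(_ x).
  apply: IH => i z im zi; have := hk i z; rewrite /=.
  by have -> : (i == m.+2) = false; [lia|apply; rewrite ?zi; lia].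
have := hk m.+2 (val y); rewrite P_in_last to_gpG_val; apply; first by lia.
exact: (valP y).
Qed.

(** The map from [G_(k + n + 1)] to [gpJ n]. *)
Definition J_in (n k : nat) (x : gpVH) : gpJ n :=
  amalgam_l (gpHomega_Q n) gpHomega_H (gpQ_in n k (to_gpG (k + n.+1) x)).

Lemma J_inM n k x y : x \in in_gpG (k + n.+1) -> y \in in_gpG (k + n.+1) ->
  J_in n k (x * y) = J_in n k x * J_in n k y.
Proof. by move=> xk yk; rewrite /J_in to_gpGM // !gmulfM. Qed.

Lemma J_inK n k x : x \in in_gpK (k + n.+1) -> J_in n k x = J_in n k.+1 x.
Proof.
move=> xk; pose c : gpK (k + n.+1) := exist _ x xk; rewrite /J_in.
rewrite -[x in LHS]/(val c) -[x in RHS]/(val c) -to_gpG_K -to_gpG_KS.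
by rewrite gpQ_glue.
Qed.

Lemma J_in_H n k h : h \in gpH_on (k + n.+1) ->
  J_in n k (1, h) = amalgam_r (gpHomega_Q n) gpHomega_H h.
Proof.
move=> hk.
have hfin : h \in gpH_fin by apply/asboolP; exists (k + n.+1)%N => //; lia.
pose h' : gpHomega := exist _ h hfin.
rewrite -[h in RHS]/(gpHomega_H h') -amalgam_glue /J_in; congr (amalgam_l _ _ _).
rewrite -[RHS]/(gpHomega_Q_fun n h') /gpHomega_Q_fun (gpH_Q_indep _ hk).
by rewrite /gpH_Q to_gpG_K.
Qed.

Lemma J_lift (T : groupType) u v n : @cone T u v ->
  exists h : {multiplicative gpJ n -> T},
    (forall k x, x \in in_gpG (k + n.+1) -> h (J_in n k x) = u (k + n.+1)%N x) /\
    (forall y, h (amalgam_r (gpHomega_Q n) gpHomega_H y) = v y).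
Proof.
move=> uv; pose w k (x : gpG (k + n.+1)) := u (k + n.+1)%N (val x).
have [k x y|k c|q qP] := @inf_amalgam_lift _ _
    (fun k => gpK_G (k + n.+1)) (fun k => gpK_GS (k + n.+1)) T w.
- by rewrite /w (coneM uv) ?(valP x) ?(valP y) //; lia.
- by rewrite /w (coneK uv) //; [lia|exact: (valP c)].
have [|h [hl hr]] := @amalgam_lift _ _ _ T (gpHomega_Q n) gpHomega_H q v
    (@gmulfM _ _ q) (cone_HM uv).
  move=> h; rewrite -[gpHomega_Q n h]/(gpHomega_Q_fun n h) /gpHomega_Q_fun.
  move: (xchooseP _) => hk; rewrite /gpH_Q [LHS]qP.
  by rewrite /w /= (cone_H uv) //; lia.
exists h; split=> // k x xk.
by rewrite /J_in hl [LHS]qP /w to_gpGK.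
Qed.

Lemma J_hom_ext (T : groupType) n (h k : {multiplicative gpJ n -> T}) :
    (forall i x, x \in in_gpG (i + n.+1) -> h (J_in n i x) = k (J_in n i x)) ->
    (forall y, h (amalgam_r (gpHomega_Q n) gpHomega_H y) =
               k (amalgam_r (gpHomega_Q n) gpHomega_H y)) ->
  h =1 k.
Proof.
move=> hk hkH; apply: amalgam_hom_ext => // x.
pose c := amalgam_l (gpHomega_Q n) gpHomega_H.
suff : (h \o c : {multiplicative _ -> _}) =1 (k \o c : {multiplicative _ -> _}).
  by move=> /(_ x).
apply: inf_amalgam_hom_ext => i y /=; have := hk i (val y) (valP y).
by rewrite /J_in to_gpG_val.
Qed.

(** The structure maps of Dunwoody's group. *)
Definition dunwoody_G (m i : nat) (x : gpVH) : dunwoody m :=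
  if (i <= m.+1)%N then amalgam_l (gpK_P m) (gpK_J m.+1) (P_in m i x)
  else amalgam_r (gpK_P m) (gpK_J m.+1) (J_in m.+1 (i - m.+2) x).

Definition dunwoody_H (m : nat) (h : gpH) : dunwoody m :=
  amalgam_r (gpK_P m) (gpK_J m.+1) (amalgam_r (gpHomega_Q m.+1) gpHomega_H h).

Lemma gpK_P_E m c : gpK_P m c = P_in m m.+1 (val c).
Proof. by rewrite P_in_last -to_gpG_K. Qed.

Lemma gpK_J_E n c : gpK_J n c = J_in n 0 (val c).
Proof. by rewrite /J_in -to_gpG_KS. Qed.

Lemma dunwoody_K m i x : (0 < i)%N -> x \in in_gpK i ->
  dunwoody_G m i x = dunwoody_G m i.+1 x.
Proof.
move=> i0 xi; rewrite /dunwoody_G; case: (ltngtP i m.+1) => im.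
- by rewrite (P_inK (m := m)) //; lia.
- have -> : (i.+1 - m.+2 = (i - m.+2).+1)%N by lia.
  congr (amalgam_r _ _ _); apply: J_inK; rewrite subnK //.
- subst i; rewrite subnn.
  pose c : gpK m.+1 := exist _ x xi.
  by rewrite -[x]/(val c) -gpK_P_E -gpK_J_E; exact: amalgam_glue.
Qed.

Lemma dunwoody_cone m : cone (dunwoody_G m) (dunwoody_H m).
Proof.
have HM : {morph dunwoody_H m : x y / x * y} by move=> x y; rewrite /dunwoody_H !gmulfM.
split=> //.
- move=> i x y i0 xi yi; rewrite /dunwoody_G; case: leqP => im.
    by rewrite P_inM ?gmulfM //; lia.
  by rewrite J_inM ?gmulfM // subnK.
- by move=> i x; exact: dunwoody_K.
- move=> i h i0 hi.
  have up k : dunwoody_G m i (1, h) = dunwoody_G m (i + k) (1, h).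
    elim: k => [|k ->]; first by rewrite addn0.
    rewrite addnS dunwoody_K //; first by lia.
    by apply: in_gpK_H; apply: gpH_on_mono hi; lia.
  rewrite (up m.+2) /dunwoody_G /dunwoody_H.
  have -> : (i + m.+2 <= m.+1)%N = false by lia.
  by rewrite addnK J_in_H //; apply: gpH_on_mono hi; lia.
Qed.

Lemma dunwoody_lift (T : groupType) u v m : @cone T u v ->
  exists h : {multiplicative dunwoody m -> T},
    (forall i x, (0 < i)%N -> x \in in_gpG i -> h (dunwoody_G m i x) = u i x) /\
    (forall y, h (dunwoody_H m y) = v y).
Proof.
move=> uv; have [p pP] := P_lift m uv; have [q [qP qH]] := J_lift m.+1 uv.
have [|h [hl hr]] := @amalgam_lift _ _ _ T (gpK_P m) (gpK_J m.+1) p q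
    (@gmulfM _ _ p) (@gmulfM _ _ q).
  move=> c; have cK := valP c; have cG := in_gpK_G cK.
  rewrite gpK_P_E gpK_J_E (pP m.+1 (val c) (leqnn _) cG).
  rewrite (qP 0%N (val c)); last exact: in_gpK_GS cK.
  exact: (coneK uv _ cK).
exists h; split=> [i x i0 xi|y]; last by rewrite /dunwoody_H hr qH.
rewrite /dunwoody_G; case: leqP => im; first by rewrite hl pP //; lia.
by rewrite hr qP ?subnK.
Qed.

Lemma dunwoody_hom_ext (T : groupType) m (h k : {multiplicative dunwoody m -> T}) :
    (forall i x, (0 < i)%N -> x \in in_gpG i -> h (dunwoody_G m i x) = k (dunwoody_G m i x)) ->
    (forall y, h (dunwoody_H m y) = k (dunwoody_H m y)) ->
  h =1 k.
Proof.
move=> hk hkH; apply: amalgam_hom_ext => x.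
  pose c := amalgam_l (gpK_P m) (gpK_J m.+1).
  suff : (h \o c : {multiplicative _ -> _}) =1 (k \o c : {multiplicative _ -> _}).
    by move=> /(_ x).
  apply: P_hom_ext => i y im yi; have := hk i y; rewrite /dunwoody_G /=.
  by have -> : (i <= m.+1)%N; [lia|apply => //; lia].
pose c := amalgam_r (gpK_P m) (gpK_J m.+1).
suff : (h \o c : {multiplicative _ -> _}) =1 (k \o c : {multiplicative _ -> _}).
  by move=> /(_ x).
apply: J_hom_ext => [i y yi|y]; last exact: hkH.
have := hk (i + m.+2)%N y; rewrite /dunwoody_G /=.
have -> : (i + m.+2 <= m.+1)%N = false by lia.
by rewrite addnK; apply => //; lia.
Qed.

(** By the universal property Dunwoody's group does not depend on where it is
    split, and every splitting gives a tree on which it acts. *)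
Lemma dunwoody_split m n : exists (phi : {multiplicative dunwoody m -> dunwoody n})
    (psi : {multiplicative dunwoody n -> dunwoody m}),
  [/\ cancel phi psi, cancel psi phi & forall h, psi (dunwoody_H n h) = dunwoody_H m h].
Proof.
have [phi [phiG phiH]] := dunwoody_lift m (dunwoody_cone n).
have [psi [psiG psiH]] := dunwoody_lift n (dunwoody_cone m).
exists phi, psi; split=> //.
  apply: (dunwoody_hom_ext (h := psi \o phi) (k := idfun)) => [i x i0 xi|h] /=.
    by rewrite phiG // psiG.
  by rewrite phiH psiH.
apply: (dunwoody_hom_ext (h := phi \o psi) (k := idfun)) => [i x i0 xi|h] /=.
  by rewrite psiG // phiG.
by rewrite psiH phiH.
Qed.

(** All the [G_i] and [H] are compatibly contained in [gpVH]; hence there are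
    homomorphisms to [gpVH] that separate their images in the amalgams. *)
Lemma gpVH_cone : @cone gpVH (fun _ x => x) (fun h => (1, h)).
Proof. by split=> // x y; congr pair; rewrite mul1g. Qed.

Lemma dunwoody_H_inj m : injective (dunwoody_H m).
Proof.
have [r [_ rH]] := dunwoody_lift m gpVH_cone.
by move=> x y /(congr1 r); rewrite !rH => -[].
Qed.

(** * The groups H_i and K_i *)

Lemma in_intervalP i j : in_interval i j = (`|j| <= i)%N.
Proof. by rewrite /in_interval; lia. Qed.

Lemma gpH_on_interval i (h : gpH) j :
  h \in gpH_on i -> in_interval i (ipfun (sval h) j) = in_interval i j.
Proof.
move=> /asboolP hi; apply/idP/idP; apply: contraLR => ji; first by rewrite hi.
have e : ipfun (sval h) (ipfun (sval h) j) = ipfun (sval h) j by rewrite hi.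
by rewrite -(can_inj (ipfunK (sval h)) e).
Qed.

(** The functions defining an element of [K_i] are determined by their values
    on [[-i, i]]; this interval is coded by ['I_(2i+1)]. *)
Lemma finite_gpK i : finite_set [set: gpK i].
Proof.
pose pt (k : 'I_(i.*2.+1)) : int := (k%:Z - i%:Z)%R.
pose idx (j : int) : 'I_(i.*2.+1) := inord `|(j + i%:Z)%R|.
have idxK j : in_interval i j -> pt (idx j) = j.
  rewrite /in_interval => ji; rewrite /pt /idx inordK; lia.
pose code (c : gpK i) := ([ffun k => (val c).1 (pt k)],
  [ffun k => idx (ipfun (sval (val c).2) (pt k))]).
have codeI : injective code.
  move=> c d [/ffunP c1 /ffunP c2].
  have /andP[/z_V/asboolP vc hc] := valP c; have /andP[/z_V/asboolP vd hd] := valP d.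
  apply: val_inj; apply/eqP/andP; split; apply/eqP.
    apply/funext => j; have [ji|ji] := boolP (in_interval i j); last by rewrite vc ?vd.
    by have := c1 (idx j); rewrite !ffunE idxK.
  apply: val_inj; apply: int_perm_eq => j.
  have [ji|ji] := boolP (in_interval i j); last first.
    by move: hc hd => /asboolP hc /asboolP hd; rewrite [LHS]hc ?[RHS]hd.
  have := c2 (idx j); rewrite !ffunE idxK // => /(congr1 pt).
  by rewrite !idxK ?gpH_on_interval.
rewrite -(eq_finite_set (inj_card_eq (in2W codeI))).
exact: finite_finset.
Qed.

Lemma finite_gpH_on i : finite_set [set h : gpH | h \in gpH_on i].
Proof.
apply: sub_finite_set (finite_image (fun c : gpK i => (val c).2) (finite_gpK i)).
by move=> h hi; exists (gpH_K hi).
Qed.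

Lemma transp01_gpH : transp01 \in generated [set transp01; int_shift].
Proof. by apply/asboolP => S; apply; left. Qed.

Lemma shift_gpH : int_shift \in generated [set transp01; int_shift].
Proof. by apply/asboolP => S; apply; right. Qed.

(** The transposition of [j] and [j + 1]. *)
Definition adjacent_transp (j : nat) : gpH :=
  (exist _ transp01 transp01_gpH : gpH) ^ ((exist _ int_shift shift_gpH : gpH) ^+ j)^-1.

Lemma adjacent_transpE j (k : int) :
  ipfun (sval (adjacent_transp j)) k = (swap01 (k - j%:Z) + j%:Z)%R.
Proof.
pose s : gpH := exist _ int_shift shift_gpH.
have shiftE (n : nat) (l : int) : ipfun (sval (s ^+ n)) l = (l + n%:Z)%R.
  elim: n l => [|n IH] l; first by rewrite addr0.
  by rewrite expgS -[LHS]/((ipfun (sval (s ^+ n)%g) l + 1)%R) IH; lia.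
have unshiftE (n : nat) (l : int) : ipfun (sval ((s ^+ n)^-1)) l = (l - n%:Z)%R.
  rewrite -[l in LHS](subrK n%:Z) -shiftE.
  exact: (ipfunK (sval (s ^+ n))).
rewrite /adjacent_transp /conjg invgK.
by rewrite -[LHS]/(ipfun (sval (s ^+ j)) (transp01 (ipfun (sval ((s ^+ j)^-1)) k))) shiftE unshiftE.
Qed.

Lemma adjacent_transp_on i j : (j < i)%N -> adjacent_transp j \in gpH_on i.
Proof.
move=> ji; apply/asboolP => k; rewrite adjacent_transpE /swap01 in_intervalP => ki.
case: eqP => [|_]; first by lia.
by case: eqP => [|_]; lia.
Qed.

Lemma adjacent_transp_inj : injective adjacent_transp.
Proof.
suff key i j : (i < j)%N -> adjacent_transp i <> adjacent_transp j.
  move=> i j ij; case: (ltngtP i j) => // [/key|/key]; [by case|].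
  by move=> /(_ (esym ij)).
move=> ij /(congr1 (fun h : gpH => ipfun (sval h) i%:Z)); rewrite !adjacent_transpE /swap01.
rewrite subrr eqxx; case: eqP => [|_]; first by lia.
by case: eqP => [|_]; lia.
Qed.

Lemma gpH_on_large N : ~ ([set h : gpH | h \in gpH_on N.+1] #<= `I_N)%card.
Proof.
move=> small; suff : (`I_N.+1 #<= `I_N)%card by rewrite card_le_II ltnn.
apply: card_le_trans small.
rewrite -(card_le_eql (inj_card_eq (f := adjacent_transp) _)); last first.
  by move=> i j _ _; exact: adjacent_transp_inj.
by apply: subset_card_le => _ [j ji <-]; exact: adjacent_transp_on.
Qed.

Lemma z_on i : z_ i \in gpV_on i.
Proof. by apply/asboolP => j /negPf ji; rewrite /z_ ji. Qed.

Lemma generated_z_constant i v (j k : int) : v \in generated [set z_ i] ->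
  in_interval i j -> in_interval i k -> v j = v k.
Proof.
move=> /asboolP vz ji ki; pose const := fun v : gpV => `[< v j = v k >].
have cM : mulg_closed const.
  move=> u w /asboolP uh /asboolP wh; apply/asboolP.
  by rewrite -[LHS]/(u j * w j) uh wh.
have c1 : 1 \in const by exact/asboolP.
have cV : invg_closed const.
  move=> u /asboolP uh; apply/asboolP.
  by rewrite -[LHS]/((u j)^-1) uh.
pose S : groupClosed gpV := HB.pack const
  (isMulClosed.Build gpV const cM) (isMul1Closed.Build gpV const c1)
  (isInvClosed.Build gpV const cV).
apply/asboolP; apply: (vz S) => _ ->; apply/asboolP.
by rewrite /z_ ji ki.
Qed.

(** The element [z_i] of [G_k], for any [k >= i]. *)
Definition zG i : gpVH := (z_ i, 1).

Lemma zG_on i k : (i <= k)%N -> zG i \in in_gpG k.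
Proof.
move=> ik; apply/andP; split; last exact: gpred1.
exact: gpV_on_mono ik _ (z_on i).
Qed.

Lemma zG_pred_notK i : zG i \notin in_gpK i.+1.
Proof.
apply/negP => /andP[/= zK _]; have := generated_z_constant (j := 0%R) (k := i.+1%:Z) zK.
by rewrite /zG /z_ !in_intervalP /= leqnn ltnn => /(_ isT isT).
Qed.

Lemma zG_succ_notK i : zG i.+1 \notin in_gpK i.
Proof.
apply/negP => /andP[/z_V/asboolP/(_ i.+1%:Z) + _].
have -> : in_interval i i.+1%:Z = false by rewrite in_intervalP; lia.
move=> /(_ isT) outside; have : in_interval i.+1 i.+1%:Z = false by exact: outside.
by rewrite in_intervalP; lia.
Qed.

Lemma zG_commute i (h : gpH) : h \in gpH_on i -> commute ((1, h) : gpVH) (zG i).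
Proof.
move=> hi; congr pair; last by rewrite [LHS]mulg1 [RHS]mul1g.
by rewrite /= (z_central hi) [LHS]mul1g act_V_one [RHS]mulg1.
Qed.

(** The sign pattern [z_i] is invariant under [H_i], so that [h] and [z_i] commute
    in every [G_k] that contains both. *)
Lemma cone_commute (T : groupType) u v i k (h : gpH) : @cone T u v ->
  (i <= k)%N -> (0 < k)%N -> h \in gpH_on i -> commute (v h) (u k (zG i)).
Proof.
move=> uv ik k0 hi.
have hk : h \in gpH_on k by exact: gpH_on_mono ik _ hi.
have hG : ((1, h) : gpVH) \in in_gpG k by exact/in_gpK_G/in_gpK_H.
have zk := zG_on ik.
by rewrite /commute -(cone_H uv k0 hk) -!(coneM uv k0) ?(zG_commute hi).
Qed.

Theorem theorem1p1 (R : realType) (m : nat) :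
  ~ has_universal_acylindrical_action R (dunwoody m).
Proof.
apply: no_universal_acylindrical_action => N; pose n := N.+1.
have [phi [psi [phiK psiK psiH]]] := dunwoody_split m n.
pose x := P_in n n.+1 (zG n); pose y := J_in n.+1 0 (zG n.+2).
pose g := amalgam_l (gpK_P n) (gpK_J n.+1) x * amalgam_r (gpK_P n) (gpK_J n.+1) y.
have zx : zG n \in in_gpG n.+1 by exact: zG_on.
have zy : zG n.+2 \in in_gpG n.+2 by exact: zG_on.
have gE : g = dunwoody_G n n.+1 (zG n) * dunwoody_G n n.+2 (zG n.+2).
  by rewrite /dunwoody_G leqnn ltnn subnn.
have [p pP] := P_lift n gpVH_cone; have [q [qP _]] := J_lift n.+1 gpVH_cone.
have pE c : p (gpK_P n c) = val c.
  by rewrite gpK_P_E pP ?leqnn //; exact/in_gpK_G/(valP c).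
have qE c : q (gpK_J n.+1 c) = val c.
  by rewrite gpK_J_E (qP 0%N (val c)) //; exact/in_gpK_GS/(valP c).
exists (psi g), [set psi (dunwoody_H n h) | h in [set h | h \in gpH_on n]]; split.
- apply: (generalized_loxodromic_inj (phi := phi)); first exact: can_inj phiK.
  rewrite psiK; apply: amalgam_generalized_loxodromic.
  + by move=> c d /(congr1 p); rewrite !pE => /val_inj.
  + by move=> c d /(congr1 q); rewrite !qE => /val_inj.
  + exact: finite_gpK.
  + move=> c /(congr1 p); rewrite pE pP ?leqnn // => zc.
    by have := zG_pred_notK n; rewrite zc (valP c).
  + move=> c /(congr1 q); rewrite qE (qP 0%N (zG n.+2)) // => zc.
    by have := zG_succ_notK n.+1; rewrite zc (valP c).
- exact/finite_image/finite_gpH_on.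
- rewrite (card_le_eql (inj_card_eq _)); first exact: gpH_on_large.
  by move=> h k _ _; rewrite !psiH => /dunwoody_H_inj.
- move=> _ _ [h hn <-] [k kn <-]; exists (h^-1 * k); first exact: gpredM (gpredVr _ hn) kn.
  have HM := cone_HM (dunwoody_cone m).
  rewrite !psiH; apply: (mulgI (dunwoody_H m h)).
  by rewrite -HM !mulVKg.
- move=> _ [h hn <-]; rewrite /commute -!gmulfM; congr (psi _); rewrite gE.
  apply: commuteM; apply: (cone_commute (dunwoody_cone n)) => //.
  by apply: gpH_on_mono hn; lia.
Qed.
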